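(* Suppose the subscheme $\Gamma\subseteq\mathbb P^3\times\mathbb P^3$ determined by the relations for $A(\alpha,\beta,\gamma)$ is finite (in which case $\alpha\beta\gamma\ne0$, so that the set $\mathfrak P$ is defined). Then $\Gamma$ is the graph of the bijection $\theta:\mathfrak P\to\ominus\mathfrak P$ and consists of $20$ distinct points.
   Context: $\Bbbk$ is a field of characteristic not $2$ containing a fixed square root $i$ of $-1$; the parameters $\alpha,\beta,\gamma\in\Bbbk$ have fixed square roots $a,b,c\in\Bbbk$ respectively. $V$ has basis $x_0,x_1,x_2,x_3$, and $A(\alpha,\beta,\gamma)=TV/(R)$ where $R\subseteq V^{\otimes2}$ is the span of the six elements $$x_0\otimes x_1-x_1\otimes x_0-\alpha(x_2\otimes x_3+x_3\otimes x_2),\qquad x_0\otimes x_1+x_1\otimes x_0-x_2\otimes x_3+x_3\otimes x_2,$$ $$x_0\otimes x_2-x_2\otimes x_0-\beta(x_3\otimes x_1+x_1\otimes x_3),\qquad x_0\otimes x_2+x_2\otimes x_0-x_3\otimes x_1+x_1\otimes x_3,$$ $$x_0\otimes x_3-x_3\otimes x_0-\gamma(x_1\otimes x_2+x_2\otimes x_1),\qquad x_0\otimes x_3+x_3\otimes x_0-x_1\otimes x_2+x_2\otimes x_1.$$ Elements of $V\otimes V$ are viewed as forms of bi-degree $(1,1)$ on $\mathbb P(V^* )\times\mathbb P(V^* )=\mathbb P^3\times\mathbb P^3$, and $\Gamma$ is the scheme-theoretic zero locus of $R$. When $\alpha\beta\gamma\neq0$, $\mathfrak P=\mathfrak P_\infty\cup\mathfrak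 P_0\cup\mathfrak P_1\cup\mathfrak P_2\cup\mathfrak P_3\subseteq\mathbb P^3$ where $\mathfrak P_\infty=\{(1,0,0,0),(0,1,0,0),(0,0,1,0),(0,0,0,1)\}$, $\mathfrak P_0=\{(abc,a,b,c),(abc,a,-b,-c),(abc,-a,b,-c),(abc,-a,-b,c)\}$, $\mathfrak P_1=\{(a,-ia,-i,-1),(a,-ia,i,1),(a,ia,-i,1),(a,ia,i,-1)\}$, $\mathfrak P_2=\{(b,-1,-ib,-i),(b,-1,ib,i),(b,1,-ib,i),(b,1,ib,-i)\}$, $\mathfrak P_3=\{(c,-i,-1,-ic),(c,-i,1,ic),(c,i,-1,ic),(c,i,1,-ic)\}$. Define $\ominus(\xi_0,\xi_1,\xi_2,\xi_3)=(-\xi_0,\xi_1,\xi_2,\xi_3)$ on $\mathbb P^3$, and $\gamma_1(\xi_0,\xi_1,\xi_2,\xi_3)=(\xi_0,\xi_1,-\xi_2,-\xi_3)$, $\gamma_2(\xi_0,\xi_1,\xi_2,\xi_3)=(\xi_0,-\xi_1,\xi_2,-\xi_3)$, $\gamma_3(\xi_0,\xi_1,\xi_2,\xi_3)=(\xi_0,-\xi_1,-\xi_2,\xi_3)$. The map $\theta:\mathfrak P\to\ominus\mathfrak P$ is $\theta(p)=p$ if $p\in\mathfrak P_\infty$, $\theta(p)=\ominus p$ if $p\in\mathfrak P_0$, and $\theta(p)=\ominus\gamma_j(p)$ if $p\in\mathfrak P_j$, $j=1,2,3$. *)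

(* Defs.v *)
From mathcomp Require Import all_boot all_order all_algebra.
Set Warnings "-notation-incompatible-prefix,-notation-overridden".
From mathcomp Require Import finmap mpoly.

Set Implicit Arguments.
Unset Strict Implicit.
Unset Printing Implicit Defensive.

Import GRing.Theory.
Local Open Scope fset_scope.
Local Open Scope ring_scope.

(** A closed subscheme Z of P^3 x P^3 is given by its ideals on the 16 standard affine charts
    U_ij = {x_i <> 0} x {y_j <> 0}.  The chart U_ij is the closed subscheme
    x_i = y_j = 1 of the affine space with coordinate ring
    k[x_0, .., x_3, y_0, .., y_3] = {mpoly k[4 + 4]}, so that the ideal of
    Z on U_ij is an ideal of {mpoly k[4 + 4]} containing x_i - 1 and y_j - 1. *)
Section Schemes.

Variable k : fieldType.

Local Notation S := {mpoly k[4 + 4]}.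

Definition xvar (i : 'I_4) : S := 'X_(lshift 4 i).
Definition yvar (j : 'I_4) : S := 'X_(rshift 4 j).

Definition ideal_gen (G : S -> Prop) (f : S) : Prop :=
  exists s : seq (S * S),
    (forall t, t \in s -> G t.2) /\ f = \sum_(t <- s) t.1 * t.2.

Definition subscheme : Type := 'I_4 -> 'I_4 -> S -> Prop.

Definition eq_subscheme (Z W : subscheme) : Prop :=
  forall i j f, Z i j f <-> W i j f.

Definition zero_locus (F : S -> Prop) : subscheme := fun i j =>
  ideal_gen (fun g => [\/ F g, g = xvar i - 1 | g = yvar j - 1]).

(** Z is finite over Spec k iff the coordinate ring of each chart of Z is
    finite-dimensional over k: an open subscheme of a finite k-scheme is
    a union of connected components of it, and a closed subscheme of P^3 x P^3
    covered by finitely many finite k-schemes is proper of dimension 0. *)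
Definition finite_subscheme (Z : subscheme) : Prop :=
  forall i j, exists e : seq S, forall f : S,
    exists u : 'I_(size e) -> k, Z i j (f - \sum_(l < size e) u l *: e`_l).

(** A k-point of P^3 is the line in k^4 spanned by its homogeneous
    coordinates.  The type contains the other subspaces as well, but the
    coordinate vectors below are nonzero as soon as a, b, c are. *)
Definition point : Type := {vspace 'rV[k]_4}.

Definition vec4 (x0 x1 x2 x3 : k) : 'rV[k]_4 := \row_j [:: x0; x1; x2; x3]`_j.

Definition pt (x0 x1 x2 x3 : k) : point := <[vec4 x0 x1 x2 x3]>%VS.

(** The reduced closed subscheme whose points are the elements of a finite set
    of k-points of P^3 x P^3: on U_ij, its ideal consists of the polynomials
    vanishing at the elements of the set that lie in U_ij. *)
Definition points_subscheme (E : {fset point * point}) : subscheme :=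
  fun i j f => forall (p q : point) (v w : 'rV[k]_4),
    (p, q) \in E -> v \in p -> w \in q -> v 0 i = 1 -> w 0 j = 1 ->
    f.@[fun l => row_mx v w 0 l] = 0.

End Schemes.

Section Gamma.

Variables (k : fieldType) (alpha beta gamma : k).

(** V (x) V is identified with 4 x 4 matrices: x_i (x) x_j is [xx i j]. *)
Local Notation xx i j := (delta_mx (i : 'I_4) (j : 'I_4) : 'M[k]_4).

Definition relation_gens : seq 'M[k]_4 :=
  [:: xx 0 1 - xx 1 0 - alpha *: (xx 2 3 + xx 3 2);
      xx 0 1 + xx 1 0 - xx 2 3 + xx 3 2;
      xx 0 2 - xx 2 0 - beta *: (xx 3 1 + xx 1 3);
      xx 0 2 + xx 2 0 - xx 3 1 + xx 1 3;
      xx 0 3 - xx 3 0 - gamma *: (xx 1 2 + xx 2 1);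
      xx 0 3 + xx 3 0 - xx 1 2 + xx 2 1].

Definition relations : {vspace 'M[k]_4} := <<relation_gens>>%VS.

Definition form11 (t : 'M[k]_4) : {mpoly k[4 + 4]} :=
  \sum_i \sum_j t i j *: (xvar k i * yvar k j).

Definition Gamma : subscheme k :=
  zero_locus (fun f => exists2 t, t \in relations & f = form11 t).

End Gamma.

Section Theta.

Variables (k : fieldType) (i a b c : k).

Local Notation point := (point k).

Definition P_inf : {fset point} :=
  [fset pt 1 0 0 0; pt 0 1 0 0; pt 0 0 1 0; pt 0 0 0 1].

Definition P_0 : {fset point} :=
  [fset pt (a * b * c) a b c; pt (a * b * c) a (- b) (- c);
        pt (a * b * c) (- a) b (- c); pt (a * b * c) (- a) (- b) c].

Definition P_1 : {fset point} :=
  [fset pt a (- (i * a)) (- i) (- 1); pt a (- (i * a)) i 1;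
        pt a (i * a) (- i) 1; pt a (i * a) i (- 1)].

Definition P_2 : {fset point} :=
  [fset pt b (- 1) (- (i * b)) (- i); pt b (- 1) (i * b) i;
        pt b 1 (- (i * b)) i; pt b 1 (i * b) (- i)].

Definition P_3 : {fset point} :=
  [fset pt c (- i) (- 1) (- (i * c)); pt c (- i) 1 (i * c);
        pt c i (- 1) (i * c); pt c i 1 (- (i * c))].

Definition PP : {fset point} := P_inf `|` P_0 `|` P_1 `|` P_2 `|` P_3.

Definition scale_coords (d0 d1 d2 d3 : k) (p : point) : point :=
  (linfun (mulmxr (diag_mx (vec4 d0 d1 d2 d3))) @: p)%VS.

Definition ominus : point -> point := scale_coords (- 1) 1 1 1.
Definition gamma1 : point -> point := scale_coords 1 1 (- 1) (- 1).
Definition gamma2 : point -> point := scale_coords 1 (- 1) 1 (- 1).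
Definition gamma3 : point -> point := scale_coords 1 (- 1) (- 1) 1.

(** Only used on [PP].  The order of the tests is immaterial when [PP] has 20
    elements, as its five pieces are then pairwise disjoint. *)
Definition theta (p : point) : point :=
  if p \in P_inf then p
  else if p \in P_0 then ominus p
  else if p \in P_1 then ominus (gamma1 p)
  else if p \in P_2 then ominus (gamma2 p)
  else ominus (gamma3 p).

Definition ominusPP : {fset point} := [fset ominus p | p in PP].

Definition theta_graph : {fset point * point} := [fset (p, theta p) | p in PP].

End Theta.

(* Main.v *)
Require Import Defs.
From HB Require Import structures.
From mathcomp Require Import all_boot all_order all_algebra.
From mathcomp Require Import finmap mpoly.
From mathcomp Require Import ring.

Set Implicit Arguments.
Unset Strict Implicit.
Unset Printing Implicit Defensive.

Import GRing.Theory.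
Local Open Scope fset_scope.
Local Open Scope ring_scope.

(** The relations are linear in each of the two factors.  Eliminating [y] from
    them, a point [x] carries a [y] only where the four-by-four minors of the
    relations vanish.  Twelve of these minors factor ([minors_in_ideal]): up to
    a factor [-2], they are the products
    [L_n * (x0 x1 - k1 x2 x3)], [L_n * (x0 x2 - k2 x3 x1)],
    [L_n * (x0 x3 - k3 x1 x2)] for [n = 0, .., 3], where [L_n] is a linear form
    in the squares of the coordinates and
    [(k1, k2, k3) = (alpha, beta, gamma), (- alpha, -1, 1), (1, - beta, -1),
    (-1, 1, - gamma)] for these values of [n].  With
    [delta = alpha + beta + gamma + alpha beta gamma] the four forms
    satisfy [delta * x_j ^ 2 = \sum_n v_nj * L_n], where
    [v_n = (k1 k2 k3, k1, k2, k3)] consists of the squares of the coordinates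
    of the points of [P_n].

    Suppose that [alpha beta gamma] and [delta] are nonzero.  Then the [L_n]
    generate the unit ideal on each chart, and where [L_n] is invertible the
    three binomials cut out the coordinate points and the four points of
    [P_n].  These are reduced, because after a diagonal change of coordinates
    the binomials become [z0 z1 = z2 z3], [z0 z2 = z3 z1], [z0 z3 = z1 z2],
    whose solutions are separated by explicit functions ([split_orbit]).  At
    each of these points the relations are a linear system of rank three in
    [y], solved by the image under [theta] ([fibre_0], .., [fibre_3],
    [fibre_coord]).  Hence, for a polynomial [f] that vanishes at the twenty
    points, [1] belongs to the colon ideal of [f] ([one_in_colon]) and [f] to
    the ideal of [Gamma] ([Gamma_reduced]).

    It remains to see that [Gamma] is infinite in the other cases.  If a
    parameter vanishes, [Gamma] contains the diagonal of a coordinate line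
    ([parameter_neq0]).  If [delta = 0], the [L_n] have a common line of zeros
    in the space of squares, which is the image of a curve in [P^3], and this
    curve lifts to [Gamma] by explicit cubic forms ([delta_neq0]).  The
    coordinates of the curve are square roots, and the field [k] may be finite,
    so the curve is replaced by its jets at a rational point, in
    [k[t] / t^N] for all [N] ([jets_not_finite]).

    The twenty points are distinct as soon as [alpha beta gamma] is nonzero:
    the three ratios [x0 x1 / x2 x3], [x0 x2 / x3 x1], [x0 x3 / x1 x2] tell
    the families [P_n] apart, and the sign changes act freely on each. *)

(** * Ideals *)

Section Ideals.

Variable A : comNzRingType.

Definition is_ideal (J : A -> Prop) : Prop :=
  J 0 /\ forall c h f, J h -> J f -> J (c * h + f).

Variable J : A -> Prop.
Hypothesis idJ : is_ideal J.

Lemma idealM c h : J h -> J (c * h).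
Proof. by move=> Jh; rewrite -[c * h]addr0; apply: idJ.2 => //; apply: idJ.1. Qed.

Lemma idealD f h : J f -> J h -> J (f + h).
Proof. by move=> Jf Jh; rewrite -[f]mul1r; apply: idJ.2. Qed.

(** Membership certificates are checked one generator at a time: [c * h] is
    subtracted for each generator [h], until the identity [e = 0] is left. *)
Lemma ideal_sub c h e : J h -> J (e - c * h) -> J e.
Proof. by move=> Jh Je; rewrite -[e](subrK (c * h)) addrC; apply: idJ.2. Qed.

Lemma ideal_eq0 e : e = 0 -> J e.
Proof. by move=> ->; apply: idJ.1. Qed.

Lemma ideal_cancel d c e : d * c = 1 -> J (c * e) -> J e.
Proof. by move=> dc /(idealM d); rewrite mulrA dc mul1r. Qed.

Lemma ideal_sum (I : Type) (r : seq I) (P : pred I) (F : I -> A) :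
  (forall i, P i -> J (F i)) -> J (\sum_(i <- r | P i) F i).
Proof. by move=> JF; elim/big_ind: _ => //; [apply: idJ.1 | apply: idealD]. Qed.

(** Cramer's rule: the determinant of a linear system annihilates its
    solutions. *)
Lemma ideal_det n (N : 'M[A]_n) (y : 'cV[A]_n) :
  (forall i, J ((N *m y) i 0)) -> forall j, J (\det N * y j 0).
Proof.
move=> JNy j; have -> : \det N * y j 0 = (\adj N *m (N *m y)) j 0.
  by rewrite mulmxA mul_adj_mx mul_scalar_mx mxE.
by rewrite mxE; apply: ideal_sum => i _; apply: idealM.
Qed.

End Ideals.

Lemma forall_ord4 (P : 'I_4 -> Prop) :
  P 0 -> P 1 -> P 2 -> P 3 -> forall m, P m.
Proof.
move=> P0 P1 P2 P3 [[|[|[|[|//]]]] lt4].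
- by rewrite (_ : Ordinal lt4 = 0) //; apply: val_inj.
- by rewrite (_ : Ordinal lt4 = 1) //; apply: val_inj.
- by rewrite (_ : Ordinal lt4 = 2) //; apply: val_inj.
- by rewrite (_ : Ordinal lt4 = 3) //; apply: val_inj.
Qed.

Section FourByFour.

Variable A : comNzRingType.

Definition mx4 (T : Type) (t : T) (s : seq (seq T)) : 'M[T]_4 :=
  \matrix_(p, q) nth t (nth [::] s p) q.

Lemma sum_ord4 (F : 'I_4 -> A) : \sum_i F i = F 0 + F 1 + F 2 + F 3.
Proof.
rewrite !big_ord_recr big_ord0 /= add0r.
by congr (F _ + F _ + F _ + F _); apply: val_inj.
Qed.

Lemma det_mx4 (m00 m01 m02 m03 m10 m11 m12 m13
               m20 m21 m22 m23 m30 m31 m32 m33 : A) :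
  \det (mx4 0 [:: [:: m00; m01; m02; m03]; [:: m10; m11; m12; m13];
                  [:: m20; m21; m22; m23]; [:: m30; m31; m32; m33]]) =
    (m00 * m11 - m01 * m10) * (m22 * m33 - m23 * m32)
  - (m00 * m12 - m02 * m10) * (m21 * m33 - m23 * m31)
  + (m00 * m13 - m03 * m10) * (m21 * m32 - m22 * m31)
  + (m01 * m12 - m02 * m11) * (m20 * m33 - m23 * m30)
  - (m01 * m13 - m03 * m11) * (m20 * m32 - m22 * m30)
  + (m02 * m13 - m03 * m12) * (m20 * m31 - m21 * m30).
Proof.
rewrite (expand_det_row _ 0) sum_ord4 /cofactor.
rewrite !(expand_det_row _ ord0) !big_ord_recl !big_ord0 /cofactor.
rewrite !(expand_det_row _ ord0) !big_ord_recl !big_ord0 /cofactor.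
rewrite !det_mx11 !mxE /=.
ring.
Qed.

End FourByFour.

(** * Elimination of the second factor *)

Section Elimination.

Variables (A : comNzRingType) (J : A -> Prop).
Hypothesis idJ : is_ideal J.

(** Each coordinate of a solution [y] multiplies the determinant into [J]; the
    coordinates of a point generate the unit ideal. *)
Lemma ideal_det4 (m00 m01 m02 m03 m10 m11 m12 m13
                  m20 m21 m22 m23 m30 m31 m32 m33 y0 y1 y2 y3 : A) :
  (forall e, J (e * y0) -> J (e * y1) -> J (e * y2) -> J (e * y3) -> J e) ->
  J (m00 * y0 + m01 * y1 + m02 * y2 + m03 * y3) ->
  J (m10 * y0 + m11 * y1 + m12 * y2 + m13 * y3) ->
  J (m20 * y0 + m21 * y1 + m22 * y2 + m23 * y3) ->
  J (m30 * y0 + m31 * y1 + m32 * y2 + m33 * y3) ->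
  J (\det (mx4 0 [:: [:: m00; m01; m02; m03]; [:: m10; m11; m12; m13];
                     [:: m20; m21; m22; m23]; [:: m30; m31; m32; m33]])).
Proof.
move=> unimod J0 J1 J2 J3; set N := mx4 _ _.
pose y := \col_(j < 4) nth 0 [:: y0; y1; y2; y3] j.
have JNy i : J ((N *m y) i 0).
  by rewrite mxE sum_ord4 !mxE; elim/forall_ord4: i.
by have JD := ideal_det idJ JNy; apply: unimod;
  [move: (JD 0) | move: (JD 1) | move: (JD 2) | move: (JD 3)]; rewrite [y _ _]mxE.
Qed.

Variables (al be ga x0 x1 x2 x3 y0 y1 y2 y3 : A).

Hypothesis unimod_y :
  forall e, J (e * y0) -> J (e * y1) -> J (e * y2) -> J (e * y3) -> J e.
Hypothesis r1 : J (x0 * y1 - x1 * y0 - al * (x2 * y3 + x3 * y2)).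
Hypothesis r2 : J (x0 * y1 + x1 * y0 - x2 * y3 + x3 * y2).
Hypothesis r3 : J (x0 * y2 - x2 * y0 - be * (x3 * y1 + x1 * y3)).
Hypothesis r4 : J (x0 * y2 + x2 * y0 - x3 * y1 + x1 * y3).
Hypothesis r5 : J (x0 * y3 - x3 * y0 - ga * (x1 * y2 + x2 * y1)).
Hypothesis r6 : J (x0 * y3 + x3 * y0 - x1 * y2 + x2 * y1).

(** Two relations of the same weight under the sign changes, completed by one
    relation of each of the other two weights, have a minor that factors.  The
    cyclic permutations of the indices 1, 2, 3 give the other minors. *)
Lemma minors_in_ideal :
  [/\ J (2 * ((x0^+2 + x1^+2 + x2^+2 + x3^+2) * (x0 * x1 - al * x2 * x3))),
      J (2 * ((x0^+2 - be * ga * x1^+2 - ga * x2^+2 + be * x3^+2) *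
              (x0 * x1 - (- al) * x2 * x3))),
      J (2 * ((x0^+2 + ga * x1^+2 - ga * al * x2^+2 - al * x3^+2) *
              (x0 * x1 - 1 * x2 * x3)))
    & J (2 * ((x0^+2 - be * x1^+2 + al * x2^+2 - al * be * x3^+2) *
              (x0 * x1 - (- 1) * x2 * x3)))].
Proof.
have R1 : J ((- x1) * y0 + x0 * y1 + (- al * x3) * y2 + (- al * x2) * y3).
  by move: r1; congr J; ring.
have R2 : J (x1 * y0 + x0 * y1 + x3 * y2 + (- x2) * y3).
  by move: r2; congr J; ring.
have R3 : J ((- x2) * y0 + (- be * x3) * y1 + x0 * y2 + (- be * x1) * y3).
  by move: r3; congr J; ring.
have R4 : J (x2 * y0 + (- x3) * y1 + x0 * y2 + x1 * y3).
  by move: r4; congr J; ring.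
have R5 : J ((- x3) * y0 + (- ga * x2) * y1 + (- ga * x1) * y2 + x0 * y3).
  by move: r5; congr J; ring.
have R6 : J (x3 * y0 + x2 * y1 + (- x1) * y2 + x0 * y3).
  by move: r6; congr J; ring.
split.
- apply: (ideal_sub idJ (ideal_det4 unimod_y R1 R2 R4 R6) (c := -1)).
  by apply: ideal_eq0 => //; rewrite det_mx4; ring.
- apply: (ideal_sub idJ (ideal_det4 unimod_y R1 R2 R3 R5) (c := -1)).
  by apply: ideal_eq0 => //; rewrite det_mx4; ring.
- apply: (ideal_sub idJ (ideal_det4 unimod_y R1 R2 R4 R5) (c := -1)).
  by apply: ideal_eq0 => //; rewrite det_mx4; ring.
- apply: (ideal_sub idJ (ideal_det4 unimod_y R1 R2 R3 R6) (c := -1)).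
  by apply: ideal_eq0 => //; rewrite det_mx4; ring.
Qed.

End Elimination.

(** * The points of one orbit *)

Section OrbitSplitting.

Variables (A : comNzRingType) (J G : A -> Prop).
Hypotheses (idJ : is_ideal J) (idG : is_ideal G).

(** Each relation trades [z0 z1] for [z2 z3], and so on; used repeatedly, they
    identify [z1 z0 ^ 4] with [z1] times the product of all coordinates. *)
Lemma split_coordinate_point (g z0 z1 z2 z3 : A) :
  (forall h, J (h * z1) -> J (h * z2) -> J (h * z3) -> G h) ->
  J (g * (z0 * z1 - z2 * z3)) -> J (g * (z0 * z2 - z3 * z1)) ->
  J (g * (z0 * z3 - z1 * z2)) ->
  G (g * (z0 ^+ 4 - z0 * z1 * z2 * z3)).
Proof.
move=> leaf H1 H2 H3; apply: leaf.
- apply: (ideal_sub idJ (c := z0 ^+ 3) H1).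
  apply: (ideal_sub idJ (c := z0 ^+ 2 * z3) H2).
  apply: (ideal_sub idJ (c := z0 * z1 * z3) H3).
  by apply: ideal_eq0 => //; ring.
- apply: (ideal_sub idJ (c := z0 ^+ 3) H2).
  apply: (ideal_sub idJ (c := z0 ^+ 2 * z1) H3).
  apply: (ideal_sub idJ (c := z0 * z2 * z1) H1).
  by apply: ideal_eq0 => //; ring.
- apply: (ideal_sub idJ (c := z0 ^+ 3) H3).
  apply: (ideal_sub idJ (c := z0 ^+ 2 * z2) H1).
  apply: (ideal_sub idJ (c := z0 * z3 * z2) H2).
  by apply: ideal_eq0 => //; ring.
Qed.

(** On the orbit of [(1, 1, 1, 1)] under sign changes, where [z0 = 1], the
    functions [1], [z1], [z2], [z3] are the characters of the group, so that
    the sum below is supported at [(1, 1, 1, 1)]. *)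
Lemma split_unit_point (g z0 z1 z2 z3 : A) :
  (forall h, J (h * (z1 - z0)) -> J (h * (z2 - z0)) -> J (h * (z3 - z0)) ->
     G h) ->
  J (g * (z0 * z1 - z2 * z3)) -> J (g * (z0 * z2 - z3 * z1)) ->
  J (g * (z0 * z3 - z1 * z2)) ->
  G (g * (z0 * z1 * z2 * z3 + z0 ^+ 3 * (z1 + z2 + z3))).
Proof.
move=> leaf H1 H2 H3; apply: leaf.
- apply: (ideal_sub idJ (c := z0 ^+ 2 * z1 - z0 ^+ 3) H1).
  apply: (ideal_sub idJ (c := - z0 ^+ 2 * z3 - z0 ^+ 3) H2).
  apply: (ideal_sub idJ (c := - z0 * z1 * z3 - z0 ^+ 3) H3).
  by apply: ideal_eq0 => //; ring.
- apply: (ideal_sub idJ (c := z0 ^+ 2 * z2 - z0 ^+ 3) H2).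
  apply: (ideal_sub idJ (c := - z0 ^+ 2 * z1 - z0 ^+ 3) H3).
  apply: (ideal_sub idJ (c := - z0 * z2 * z1 - z0 ^+ 3) H1).
  by apply: ideal_eq0 => //; ring.
- apply: (ideal_sub idJ (c := z0 ^+ 2 * z3 - z0 ^+ 3) H3).
  apply: (ideal_sub idJ (c := - z0 ^+ 2 * z2 - z0 ^+ 3) H1).
  apply: (ideal_sub idJ (c := - z0 * z3 * z2 - z0 ^+ 3) H2).
  by apply: ideal_eq0 => //; ring.
Qed.

(** The sign changes of [(z1, z2, z3)] that preserve the system
    [z0 z1 = z2 z3], [z0 z2 = z3 z1], [z0 z3 = z1 z2]. *)
Definition signs (R : pzRingType) : seq (seq R) :=
  [:: [:: 1; 1; 1; 1]; [:: 1; 1; -1; -1]; [:: 1; -1; 1; -1];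
      [:: 1; -1; -1; 1]].

(** The coordinate points and the orbit of [(1, 1, 1, 1)] are the solutions of
    the system, with multiplicity one.  For the product [T] of the
    coordinates, [z i ^+ 4 - T] localizes at a coordinate point, and [4 T] is
    the sum of four functions that localize at the points of the orbit. *)
Lemma split_orbit (g : A) (z : 'I_4 -> A) :
  (forall h i, (forall m, m != i -> J (h * z m)) -> G h) ->
  (forall h s, s \in signs A ->
     (forall m : 'I_4, J (h * (z m - s`_m * z 0))) -> G h) ->
  J (g * (z 0 * z 1 - z 2 * z 3)) -> J (g * (z 0 * z 2 - z 3 * z 1)) ->
  J (g * (z 0 * z 3 - z 1 * z 2)) ->
  forall i, G (4 * (g * z i ^+ 4)).
Proof.
move=> leaf_coord leaf_unit H1 H2 H3.
pose T := z 0 * z 1 * z 2 * z 3.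
have Gunit s : s \in signs A ->
    G (g * (T + z 0 ^+ 3 * (s`_1 * z 1 + s`_2 * z 2 + s`_3 * z 3))).
  move=> s_in; have leaf h : J (h * (s`_1 * z 1 - z 0)) ->
      J (h * (s`_2 * z 2 - z 0)) -> J (h * (s`_3 * z 3 - z 0)) -> G h.
    move=> h1 h2 h3; apply: (leaf_unit _ s s_in).
    have h0 : J (h * (s`_0 * z 0 - z 0)).
      apply: ideal_eq0 => //; move: s_in; rewrite !inE.
      by case/or4P => /eqP -> /=; ring.
    have cert m hm : J hm -> h * (z m - s`_m * z 0) = s`_m * hm ->
        J (h * (z m - s`_m * z 0)) by move=> Jm ->; apply: idealM.
    apply: forall_ord4;
      [apply: cert h0 _ | apply: cert h1 _ | apply: cert h2 _ | apply: cert h3 _];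
      by move: s_in; rewrite !inE; case/or4P => /eqP -> /=; ring.
  have := split_unit_point (g := g) leaf.
  have -> : z 0 * (s`_1 * z 1) * (s`_2 * z 2) * (s`_3 * z 3) = T.
    by rewrite /T; move: s_in; rewrite !inE; case/or4P => /eqP -> /=; ring.
  by apply;
    [apply: (ideal_sub idJ (c := s`_1) H1) | apply: (ideal_sub idJ (c := s`_2) H2)
    | apply: (ideal_sub idJ (c := s`_3) H3)]; apply: ideal_eq0 => //;
    move: s_in; rewrite !inE; case/or4P => /eqP -> /=; ring.
have GT : G (g * T *+ 4).
  apply: (ideal_sub idG (c := 1) (Gunit [:: 1; 1; 1; 1] _)); first by rewrite !inE eqxx.
  apply: (ideal_sub idG (c := 1) (Gunit [:: 1; 1; -1; -1] _));
    first by rewrite !inE eqxx ?orbT.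
  apply: (ideal_sub idG (c := 1) (Gunit [:: 1; -1; 1; -1] _));
    first by rewrite !inE eqxx ?orbT.
  apply: (ideal_sub idG (c := 1) (Gunit [:: 1; -1; -1; 1] _));
    first by rewrite !inE eqxx ?orbT.
  by apply: ideal_eq0 => //=; ring.
have Gcoord i : G (g * (z i ^+ 4 - T)).
  elim/forall_ord4: i.
  - have -> : T = z 0 * z 1 * z 2 * z 3 by rewrite /T; ring.
    apply: split_coordinate_point => // h h1 h2 h3.
    by apply: (leaf_coord h 0); apply: forall_ord4.
  - have -> : T = z 1 * z 0 * z 3 * z 2 by rewrite /T; ring.
    apply: split_coordinate_point => [h h0 h3 h2|||].
    + by apply: (leaf_coord h 1); apply: forall_ord4.
    + by apply: (ideal_sub idJ (c := 1) H1); apply: ideal_eq0 => //; ring.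
    + by apply: (ideal_sub idJ (c := -1) H2); apply: ideal_eq0 => //; ring.
    + by apply: (ideal_sub idJ (c := -1) H3); apply: ideal_eq0 => //; ring.
  - have -> : T = z 2 * z 3 * z 0 * z 1 by rewrite /T; ring.
    apply: split_coordinate_point => [h h3 h0 h1|||].
    + by apply: (leaf_coord h 2); apply: forall_ord4.
    + by apply: (ideal_sub idJ (c := -1) H1); apply: ideal_eq0 => //; ring.
    + by apply: (ideal_sub idJ (c := 1) H2); apply: ideal_eq0 => //; ring.
    + by apply: (ideal_sub idJ (c := -1) H3); apply: ideal_eq0 => //; ring.
  - have -> : T = z 3 * z 2 * z 1 * z 0 by rewrite /T; ring.
    apply: split_coordinate_point => [h h2 h1 h0|||].
    + by apply: (leaf_coord h 3); apply: forall_ord4.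
    + by apply: (ideal_sub idJ (c := -1) H1); apply: ideal_eq0 => //; ring.
    + by apply: (ideal_sub idJ (c := -1) H2); apply: ideal_eq0 => //; ring.
    + by apply: (ideal_sub idJ (c := 1) H3); apply: ideal_eq0 => //; ring.
move=> i; apply: (ideal_sub idG (c := 4) (Gcoord i)).
apply: (ideal_sub idG (c := 1) GT).
by apply: ideal_eq0 => //; ring.
Qed.

End OrbitSplitting.

(** * Solutions of the relations modulo an ideal *)

Definition rels (A : comNzRingType) (al be ga : A) (x y : 'I_4 -> A) : seq A :=
  [:: x 0 * y 1 - x 1 * y 0 - al * (x 2 * y 3 + x 3 * y 2);
      x 0 * y 1 + x 1 * y 0 - x 2 * y 3 + x 3 * y 2;
      x 0 * y 2 - x 2 * y 0 - be * (x 3 * y 1 + x 1 * y 3);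
      x 0 * y 2 + x 2 * y 0 - x 3 * y 1 + x 1 * y 3;
      x 0 * y 3 - x 3 * y 0 - ga * (x 1 * y 2 + x 2 * y 1);
      x 0 * y 3 + x 3 * y 0 - x 1 * y 2 + x 2 * y 1].

Section Solutions.

Variables (A : comNzRingType) (J : A -> Prop).
Hypothesis idJ : is_ideal J.

Definition solves (al be ga h : A) (x y : 'I_4 -> A) : Prop :=
  forall r, r \in rels al be ga x y -> J (h * r).

Lemma solvesP al be ga h x y :
  solves al be ga h x y <->
  forall p : 'I_6, J (h * (rels al be ga x y)`_p).
Proof.
split=> [sol p | sol r]; first by apply: sol; rewrite mem_nth.
by case/(nthP 0) => p lt_p <-; apply: (sol (Ordinal lt_p)).
Qed.

(** On a chart one coordinate is [1] modulo [J].  This weaker property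
    survives sign changes, which may replace that coordinate by [-1]. *)
Definition unimodular (x : 'I_4 -> A) : Prop :=
  forall e, (forall m, J (e * x m)) -> J e.

Definition proportional (h : A) (x v : 'I_4 -> A) : Prop :=
  forall l m, J (h * (x l * v m - x m * v l)).

Definition twist (s x : 'I_4 -> A) : 'I_4 -> A := fun m => s m * x m.

(** The relations are linear in [x]: multiplied by a coordinate [x l], they can
    be evaluated at [v] in place of [x], at the cost of a factor [v l]. *)
Lemma solves_proportional al be ga h x v y :
  unimodular x -> proportional h x v -> solves al be ga 1 x y ->
  solves al be ga h v y.
Proof.
move=> unimod_x prop sol; apply/solvesP => p; apply: unimod_x => l.
have Jp := (solvesP _ _ _ _ _ _).1 sol p.
apply: (ideal_sub idJ (c := h * v l) Jp).
have P m : J (h * (x l * v m - x m * v l)) by [].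
case: p {Jp} => [[|[|[|[|[|[|//]]]]]] lt_p] /=.
- apply: (ideal_sub idJ (c := y 1) (P 0)).
  apply: (ideal_sub idJ (c := - y 0) (P 1)).
  apply: (ideal_sub idJ (c := - al * y 3) (P 2)).
  apply: (ideal_sub idJ (c := - al * y 2) (P 3)).
  by apply: ideal_eq0 => //; ring.
- apply: (ideal_sub idJ (c := y 1) (P 0)).
  apply: (ideal_sub idJ (c := y 0) (P 1)).
  apply: (ideal_sub idJ (c := - y 3) (P 2)).
  apply: (ideal_sub idJ (c := y 2) (P 3)).
  by apply: ideal_eq0 => //; ring.
- apply: (ideal_sub idJ (c := y 2) (P 0)).
  apply: (ideal_sub idJ (c := - y 0) (P 2)).
  apply: (ideal_sub idJ (c := - be * y 1) (P 3)).
  apply: (ideal_sub idJ (c := - be * y 3) (P 1)).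
  by apply: ideal_eq0 => //; ring.
- apply: (ideal_sub idJ (c := y 2) (P 0)).
  apply: (ideal_sub idJ (c := y 0) (P 2)).
  apply: (ideal_sub idJ (c := - y 1) (P 3)).
  apply: (ideal_sub idJ (c := y 3) (P 1)).
  by apply: ideal_eq0 => //; ring.
- apply: (ideal_sub idJ (c := y 3) (P 0)).
  apply: (ideal_sub idJ (c := - y 0) (P 3)).
  apply: (ideal_sub idJ (c := - ga * y 2) (P 1)).
  apply: (ideal_sub idJ (c := - ga * y 1) (P 2)).
  by apply: ideal_eq0 => //; ring.
- apply: (ideal_sub idJ (c := y 3) (P 0)).
  apply: (ideal_sub idJ (c := y 0) (P 3)).
  apply: (ideal_sub idJ (c := - y 2) (P 1)).
  apply: (ideal_sub idJ (c := y 1) (P 2)).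
  by apply: ideal_eq0 => //; ring.
Qed.

Lemma proportional_from0 h y w d :
  d * w 0 = 1 -> (forall m, J (h * (y m * w 0 - y 0 * w m))) ->
  proportional h y w.
Proof.
move=> dw H l m; apply: (ideal_cancel idJ dw).
apply: (ideal_sub idJ (c := w m) (H l)).
apply: (ideal_sub idJ (c := - w l) (H m)).
by apply: ideal_eq0 => //; ring.
Qed.

(** Each relation is an eigenvector of the sign changes, when these act
    simultaneously on the two factors. *)
Lemma solves_twist al be ga h x y s :
  s \in signs A -> solves al be ga h x y ->
  solves al be ga h (twist (fun m : 'I_4 => s`_m) x)
                    (twist (fun m : 'I_4 => s`_m) y).
Proof.
move=> s_in /solvesP sol; apply/solvesP => p; rewrite /twist.
have cert q e : e = s`_q * (h * (rels al be ga x y)`_p) -> J e.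
  by move=> ->; apply: idealM.
case: p sol cert => [[|[|[|[|[|[|//]]]]]] lt_p] sol cert /=;
  [apply: (cert 1%N) | apply: (cert 1%N) | apply: (cert 2%N) |
   apply: (cert 2%N) | apply: (cert 3%N) | apply: (cert 3%N)];
  move: s_in; rewrite !inE; case/or4P => /eqP -> /=; ring.
Qed.

Lemma unimodular_twist x s :
  s \in signs A -> unimodular x -> unimodular (twist (fun m : 'I_4 => s`_m) x).
Proof.
move=> s_in unimod e He; apply: unimod => m.
have -> : e * x m = s`_m * (e * (s`_m * x m)).
  by elim/forall_ord4: m; move: s_in; rewrite !inE;
    case/or4P => /eqP -> /=; ring.
by apply: (idealM idJ); apply: He.
Qed.

Lemma proportional_twist h x v s :
  s \in signs A -> proportional h (twist (fun m : 'I_4 => s`_m) x) v ->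
  proportional h x (twist (fun m : 'I_4 => s`_m) v).
Proof.
move=> s_in H l m; have -> : h * (x l * (s`_m * v m) - x m * (s`_l * v l)) =
    s`_l * s`_m * (h * (s`_l * x l * v m - s`_m * x m * v l)); last first.
  by apply: (idealM idJ); apply: H.
have sq (q : 'I_4) : s`_q * s`_q = 1.
  by elim/forall_ord4: q; move: s_in; rewrite !inE; case/or4P => /eqP -> /=; ring.
have := sq l; have := sq m; move: s`_l s`_m => t u hu ht; ring: ht hu.
Qed.

End Solutions.

Section Fibres.

Variables (k : fieldType) (A : comNzRingType) (io : {rmorphism k -> A}).
Variable J : A -> Prop.
Hypothesis idJ : is_ideal J.

Definition emb (v : 'rV[k]_4) : 'I_4 -> A := fun m => io (v 0 m).

Lemma ideal_scalar (t : k) e : t != 0 -> J (io t * e) -> J e.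
Proof.
by move=> t0; apply: (ideal_cancel idJ (d := io t^-1)); rewrite -rmorphM mulVf ?rmorph1.
Qed.

Lemma proportional_emb h y (w : 'rV[k]_4) :
  w 0 0 != 0 -> (forall m, J (h * (y m * io (w 0 0) - y 0 * io (w 0 m)))) ->
  proportional J h y (emb w).
Proof.
move=> w0; apply: (proportional_from0 idJ (d := io (w 0 0)^-1)).
by rewrite /emb -rmorphM mulVf ?rmorph1.
Qed.

Variables (i a b c : k).
Hypotheses (two0 : (2 : k) != 0) (hi : i ^+ 2 = -1).
Hypotheses (a0 : a != 0) (b0 : b != 0) (c0 : c != 0).

Variables (h : A) (y : 'I_4 -> A).

Let sol v := solves J (io (a ^+ 2)) (io (b ^+ 2)) (io (c ^+ 2)) h (emb v) y.

Let iio : io i ^+ 2 = -1.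
Proof. by rewrite -rmorphXn hi rmorphN1. Qed.

(** With [y = w * z] coordinatewise, where [w] is the image of the given point
    under [theta], three of the six relations become [z0 + z1 = z2 + z3],
    [z0 + z2 = z3 + z1] and [z0 + z3 = z1 + z2], which force [2 z0 = 2 z1 =
    2 z2 = 2 z3].  Which three these are depends on the family. *)
Lemma fibre_0 : sol (vec4 (a * b * c) a b c) ->
  proportional J h y (emb (vec4 (- (a * b * c)) a b c)).
Proof.
move/solvesP => H; apply: proportional_emb; first by rewrite mxE oppr_eq0 !mulf_neq0.
have := H 0; have := H 2; have := H 4; rewrite /emb /= => H5 H3 H1.
rewrite !mxE /= in H5 H3 H1.
apply: forall_ord4; rewrite !mxE /=.
- by apply: ideal_eq0 => //; ring.
- apply: (@ideal_scalar (2 * b * c)); first by rewrite !mulf_neq0.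
  apply: (ideal_sub idJ (c := io (a * c)) H3).
  apply: (ideal_sub idJ (c := io (a * b)) H5).
  by apply: ideal_eq0 => //; ring.
- apply: (@ideal_scalar (2 * a * c)); first by rewrite !mulf_neq0.
  apply: (ideal_sub idJ (c := io (b * a)) H5).
  apply: (ideal_sub idJ (c := io (b * c)) H1).
  by apply: ideal_eq0 => //; ring.
- apply: (@ideal_scalar (2 * a * b)); first by rewrite !mulf_neq0.
  apply: (ideal_sub idJ (c := io (c * b)) H1).
  apply: (ideal_sub idJ (c := io (c * a)) H3).
  by apply: ideal_eq0 => //; ring.
Qed.

Lemma fibre_1 : sol (vec4 a (- (i * a)) (- i) (- 1)) ->
  proportional J h y (emb (vec4 (- a) (- (i * a)) i 1)).
Proof.
move/solvesP => H; apply: proportional_emb; first by rewrite mxE oppr_eq0.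
have := H 0; have := H 3; have := H 5; rewrite /emb /= => H6 H4 H1.
rewrite !mxE /= in H6 H4 H1.
apply: forall_ord4; rewrite !mxE /=.
- by apply: ideal_eq0 => //; ring.
- apply: (@ideal_scalar 2) => //.
  apply: (ideal_sub idJ (c := - io a) H4).
  apply: (ideal_sub idJ (c := - io (i * a)) H6).
  by apply: ideal_eq0 => //; ring: iio.
- apply: (@ideal_scalar (2 * a)); first by rewrite !mulf_neq0.
  apply: (ideal_sub idJ (c := - 1) H1).
  apply: (ideal_sub idJ (c := io (i * a)) H6).
  by apply: ideal_eq0 => //; ring: iio.
- apply: (@ideal_scalar (2 * a)); first by rewrite !mulf_neq0.
  apply: (ideal_sub idJ (c := io i) H1).
  apply: (ideal_sub idJ (c := - io (i * a)) H4).
  by apply: ideal_eq0 => //; ring: iio.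
Qed.

Lemma fibre_2 : sol (vec4 b (- 1) (- (i * b)) (- i)) ->
  proportional J h y (emb (vec4 (- b) 1 (- (i * b)) i)).
Proof.
move/solvesP => H; apply: proportional_emb; first by rewrite mxE oppr_eq0.
have := H 2; have := H 5; have := H 1; rewrite /emb /= => H6 H4 H1.
rewrite !mxE /= in H6 H4 H1.
apply: forall_ord4; rewrite !mxE /=.
- by apply: ideal_eq0 => //; ring.
- apply: (@ideal_scalar (2 * b)); first by rewrite !mulf_neq0.
  apply: (ideal_sub idJ (c := io i) H1).
  apply: (ideal_sub idJ (c := - io (i * b)) H4).
  by apply: ideal_eq0 => //; ring: iio.
- apply: (@ideal_scalar 2) => //.
  apply: (ideal_sub idJ (c := - io b) H4).
  apply: (ideal_sub idJ (c := - io (i * b)) H6).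
  by apply: ideal_eq0 => //; ring: iio.
- apply: (@ideal_scalar (2 * b)); first by rewrite !mulf_neq0.
  apply: (ideal_sub idJ (c := - 1) H1).
  apply: (ideal_sub idJ (c := io (i * b)) H6).
  by apply: ideal_eq0 => //; ring: iio.
Qed.

Lemma fibre_3 : sol (vec4 c (- i) (- 1) (- (i * c))) ->
  proportional J h y (emb (vec4 (- c) i 1 (- (i * c)))).
Proof.
move/solvesP => H; apply: proportional_emb; first by rewrite mxE oppr_eq0.
have := H 4; have := H 1; have := H 3; rewrite /emb /= => H6 H4 H1.
rewrite !mxE /= in H6 H4 H1.
apply: forall_ord4; rewrite !mxE /=.
- by apply: ideal_eq0 => //; ring.
- apply: (@ideal_scalar (2 * c)); first by rewrite !mulf_neq0.
  apply: (ideal_sub idJ (c := - 1) H1).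
  apply: (ideal_sub idJ (c := io (i * c)) H6).
  by apply: ideal_eq0 => //; ring: iio.
- apply: (@ideal_scalar (2 * c)); first by rewrite !mulf_neq0.
  apply: (ideal_sub idJ (c := io i) H1).
  apply: (ideal_sub idJ (c := - io (i * c)) H4).
  by apply: ideal_eq0 => //; ring: iio.
- apply: (@ideal_scalar 2) => //.
  apply: (ideal_sub idJ (c := - io c) H4).
  apply: (ideal_sub idJ (c := - io (i * c)) H6).
  by apply: ideal_eq0 => //; ring: iio.
Qed.

Lemma proportional_coord (z : 'I_4 -> A) m :
  (forall l, l != m -> J (h * z l)) ->
  proportional J h z (emb (\row_l (l == m)%:R)).
Proof.
move=> H l l'; rewrite /emb !mxE.
case: (eqVneq l m) => [-> | lm]; case: (eqVneq l' m) => [-> | lm'] /=;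
  rewrite ?mulr0n ?mulr1n ?rmorph0 ?rmorph1.
- by apply: ideal_eq0 => //; ring.
- by apply: (ideal_sub idJ (c := -1) (H _ lm')); apply: ideal_eq0 => //; ring.
- by apply: (ideal_sub idJ (c := 1) (H _ lm)); apply: ideal_eq0 => //; ring.
- by apply: ideal_eq0 => //; ring.
Qed.

Lemma fibre_coord m : sol (\row_l (l == m)%:R) ->
  proportional J h y (emb (\row_l (l == m)%:R)).
Proof.
move/solvesP => H; apply: proportional_coord => l.
have := H 5; have := H 4; have := H 3; have := H 2; have := H 1; have := H 0.
elim/forall_ord4: m {H} => /= H0 H1 H2 H3 H4 H5; elim/forall_ord4: l => // _;
  rewrite /emb /= !mxE /= in H0 H1 H2 H3 H4 H5.
- by apply: (ideal_sub idJ (c := 1) H0); apply: ideal_eq0 => //; ring.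
- by apply: (ideal_sub idJ (c := 1) H2); apply: ideal_eq0 => //; ring.
- by apply: (ideal_sub idJ (c := 1) H4); apply: ideal_eq0 => //; ring.
- by apply: (ideal_sub idJ (c := -1) H0); apply: ideal_eq0 => //; ring.
- by apply: (ideal_sub idJ (c := -1) H5); apply: ideal_eq0 => //; ring.
- by apply: (ideal_sub idJ (c := 1) H3); apply: ideal_eq0 => //; ring.
- by apply: (ideal_sub idJ (c := -1) H2); apply: ideal_eq0 => //; ring.
- by apply: (ideal_sub idJ (c := 1) H5); apply: ideal_eq0 => //; ring.
- by apply: (ideal_sub idJ (c := -1) H1); apply: ideal_eq0 => //; ring.
- by apply: (ideal_sub idJ (c := -1) H4); apply: ideal_eq0 => //; ring.
- by apply: (ideal_sub idJ (c := -1) H3); apply: ideal_eq0 => //; ring.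
- by apply: (ideal_sub idJ (c := 1) H1); apply: ideal_eq0 => //; ring.
Qed.

End Fibres.

(** * The twenty points *)

Section Points.

Variable k : fieldType.

Definition twist_row (s : seq k) (v : 'rV[k]_4) : 'rV[k]_4 :=
  \row_m (s`_m * v 0 m).

Definition orbit_pairs (u w : 'rV[k]_4) : seq ('rV[k]_4 * 'rV[k]_4) :=
  [seq (twist_row s u, twist_row s w) | s <- signs k].

Definition coord_row (m : 'I_4) : 'rV[k]_4 := \row_l (l == m)%:R.

Definition coord_pairs : seq ('rV[k]_4 * 'rV[k]_4) :=
  [seq (coord_row m, coord_row m) | m <- [:: 0; 1; 2; 3]].

(** [theta] commutes with the sign changes, which act transitively on each
    family: one point over each family determines the graph. *)
Definition graph_pairs (i a b c : k) : seq ('rV[k]_4 * 'rV[k]_4) :=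
  coord_pairs
  ++ orbit_pairs (vec4 (a * b * c) a b c) (vec4 (- (a * b * c)) a b c)
  ++ orbit_pairs (vec4 a (- (i * a)) (- i) (- 1)) (vec4 (- a) (- (i * a)) i 1)
  ++ orbit_pairs (vec4 b (- 1) (- (i * b)) (- i)) (vec4 (- b) 1 (- (i * b)) i)
  ++ orbit_pairs (vec4 c (- i) (- 1) (- (i * c))) (vec4 (- c) i 1 (- (i * c))).

End Points.

(** * Reduction to the twenty points *)

Section ColonIdeal.

Variables (k : fieldType) (A : comNzRingType) (io : {rmorphism k -> A}).
Variables J G : A -> Prop.
(** [J] is the ideal of [Gamma] on a chart.  [G] is the colon ideal
    [(J : f)] of a polynomial [f] that vanishes at the twenty points; all that
    matters is that [h] belongs to [G] when it localizes at one of them. *)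
Hypotheses (idJ : is_ideal J) (idG : is_ideal G).
Hypothesis JG : forall e, J e -> G e.

Variables (i a b c : k).
Hypotheses (two0 : (2 : k) != 0) (hi : i ^+ 2 = -1).
Hypotheses (a0 : a != 0) (b0 : b != 0) (c0 : c != 0).

Variables (x y : 'I_4 -> A) (p q : 'I_4).
Hypotheses (xp1 : J (x p - 1)) (yq1 : J (y q - 1)).
Hypothesis sol :
  solves J (io (a ^+ 2)) (io (b ^+ 2)) (io (c ^+ 2)) 1 x y.

Hypothesis leaf : forall h v w, (v, w) \in graph_pairs i a b c ->
  proportional J h x (emb io v) -> proportional J h y (emb io w) -> G h.

Lemma unimodular_chart (z : 'I_4 -> A) m : J (z m - 1) -> unimodular J z.
Proof.
move=> zm e He; apply: (ideal_sub idJ (c := 1) (He m)).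
by apply: (ideal_sub idJ (c := - e) zm); apply: ideal_eq0 => //; ring.
Qed.

Let unimod_x : unimodular J x := unimodular_chart xp1.
Let unimod_y : unimodular J y := unimodular_chart yq1.

Lemma proportional_ext h (z v v' : 'I_4 -> A) :
  v =1 v' -> proportional J h z v -> proportional J h z v'.
Proof. by move=> vv' H l m; rewrite -!vv'; apply: H. Qed.

(** Dividing [x m] by the coordinate [u 0 m] of a point of the family brings the
    three binomials to the form [z0 z1 = z2 z3], and so on.  Then [g] times
    the fourth power of a coordinate that equals [1] splits into elements
    that localize at single points. *)
Lemma orbit_in_colon (u w : 'rV[k]_4) (k1 k2 k3 : k) (g : A) :
  (forall h z, solves J (io (a ^+ 2)) (io (b ^+ 2)) (io (c ^+ 2)) h (emb io u) z ->
     proportional J h z (emb io w)) ->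
  {subset orbit_pairs u w <= graph_pairs i a b c} ->
  (forall m, u 0 m != 0) ->
  u 0 0 * u 0 1 = k1 * (u 0 2 * u 0 3) ->
  u 0 0 * u 0 2 = k2 * (u 0 3 * u 0 1) ->
  u 0 0 * u 0 3 = k3 * (u 0 1 * u 0 2) ->
  J (g * (x 0 * x 1 - io k1 * x 2 * x 3)) ->
  J (g * (x 0 * x 2 - io k2 * x 3 * x 1)) ->
  J (g * (x 0 * x 3 - io k3 * x 1 * x 2)) -> G g.
Proof.
move=> fibre sub u0 e1 e2 e3 H1 H2 H3.
pose z m := io (u 0 m)^-1 * x m.
have uz m : x m = io (u 0 m) * z m.
  by rewrite mulrA -rmorphM mulfV // rmorph1 mul1r.
have scale l1 l2 l3 l4 t : u 0 l1 * u 0 l2 = t * (u 0 l3 * u 0 l4) ->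
    J (g * (x l1 * x l2 - io t * x l3 * x l4)) ->
    J (g * (z l1 * z l2 - z l3 * z l4)).
  move=> e; rewrite !uz => H; have E := congr1 io e; rewrite !rmorphM in E.
  apply: (@ideal_scalar _ _ io J idJ (u 0 l1 * u 0 l2)) => //.
    by rewrite mulf_neq0.
  apply: (ideal_sub idJ (c := 1) H); apply: ideal_eq0 => //.
  ring: E.
have G4 : forall m, G (4 * (g * z m ^+ 4)).
apply: (split_orbit idJ idG (g := g) (z := z)).
- move=> h m Hz; have Hx l : l != m -> J (h * x l).
    move=> lm; rewrite uz; apply: (ideal_sub idJ (c := io (u 0 l)) (Hz l lm)).
    by apply: ideal_eq0 => //; ring.
  have Px := proportional_coord io idJ Hx.
  apply: (leaf (v := coord_row k m) (w := coord_row k m)) => //.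
    rewrite mem_cat; apply/orP; left; apply: map_f.
    by elim/forall_ord4: m {Hz Hx Px}; rewrite !inE.
  apply: (fibre_coord (io := io) idJ (a := a) (b := b) (c := c)).
  exact (solves_proportional idJ unimod_x Px sol).
- move=> h s' s'_in Hz.
  have [s s_in es] : exists2 s, s \in signs k & s' = map io s.
    have : s' \in map (map io) (signs k).
      by rewrite /signs /= !rmorphN1 rmorph1.
    by case/mapP => s; exists s.
  have s'E m : s'`_m = io s`_m.
    rewrite es; case: (ltnP m (size s)) => lt_m; first by rewrite (nth_map 0).
    by rewrite !nth_default ?rmorph0 ?size_map.
  have Px : proportional J h (twist (fun m : 'I_4 => s'`_m) x) (emb io u).
    move=> l m; rewrite /twist /emb !uz.
    have sq (r : 'I_4) : s'`_r * s'`_r = 1.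
      by elim/forall_ord4: r; move: s'_in; rewrite !inE;
        case/or4P => /eqP -> /=; ring.
    apply: (ideal_sub idJ (c := s'`_l * io (u 0 l) * io (u 0 m)) (Hz l)).
    apply: (ideal_sub idJ (c := - s'`_m * io (u 0 l) * io (u 0 m)) (Hz m)).
    apply: ideal_eq0 => //; have := sq l; have := sq m.
    move: s'`_l s'`_m => t r hr ht; ring: hr ht.
  have Py : proportional J h (twist (fun m : 'I_4 => s'`_m) y) (emb io w).
    apply: fibre; have tsol := solves_twist idJ s'_in sol.
    exact (solves_proportional idJ (unimodular_twist idJ s'_in unimod_x) Px tsol).
  apply: (leaf (v := twist_row s u) (w := twist_row s w)).
  + by apply: sub; apply: map_f.
  + apply: proportional_ext (proportional_twist idJ s'_in Px) => m.
    by rewrite /twist /emb mxE rmorphM s'E.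
  + apply: proportional_ext (proportional_twist idJ s'_in Py) => m.
    by rewrite /twist /emb mxE rmorphM s'E.
- exact: scale e1 H1.
- exact: scale e2 H2.
- exact: scale e3 H3.
have four0 : (4 * (u 0 p)^-1 ^+ 4 : k) != 0.
  rewrite (_ : 4 = 2 * 2) ?mulf_neq0 ?expf_neq0 ?invr_neq0 //; ring.
apply: (@ideal_scalar _ _ io G idG _ _ four0).
apply: (ideal_sub idG (c := 1) (G4 p)).
apply: JG; apply: (ideal_sub idJ (c := - (io (4 * (u 0 p)^-1 ^+ 4)) * g *
  (x p ^+ 3 + x p ^+ 2 + x p + 1)) xp1).
by apply: ideal_eq0 => //; rewrite /z; ring.
Qed.

(** The forms [L_n] belong to [G] by [orbit_in_colon], hence so does their
    combination [delta * x p ^+ 2]. *)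
Lemma one_in_colon :
  a ^+ 2 + b ^+ 2 + c ^+ 2 + a ^+ 2 * b ^+ 2 * c ^+ 2 != 0 -> G 1.
Proof.
move=> delta0.
have i0 : i != 0.
  by apply/eqP => i0; move/eqP: hi; rewrite i0 expr0n eq_sym oppr_eq0 oner_eq0.
have unimod4 e : J (e * y 0) -> J (e * y 1) -> J (e * y 2) -> J (e * y 3) -> J e.
  by move=> h0 h1 h2 h3; apply: unimod_y; apply: forall_ord4.
pose al := io (a ^+ 2); pose be := io (b ^+ 2); pose ga := io (c ^+ 2).
have R r : r \in rels al be ga x y -> J r by move/sol; rewrite mul1r.
have r1 : J (x 0 * y 1 - x 1 * y 0 - al * (x 2 * y 3 + x 3 * y 2)).
  by apply: R; rewrite !inE eqxx ?orbT.
have r2 : J (x 0 * y 1 + x 1 * y 0 - x 2 * y 3 + x 3 * y 2).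
  by apply: R; rewrite !inE eqxx ?orbT.
have r3 : J (x 0 * y 2 - x 2 * y 0 - be * (x 3 * y 1 + x 1 * y 3)).
  by apply: R; rewrite !inE eqxx ?orbT.
have r4 : J (x 0 * y 2 + x 2 * y 0 - x 3 * y 1 + x 1 * y 3).
  by apply: R; rewrite !inE eqxx ?orbT.
have r5 : J (x 0 * y 3 - x 3 * y 0 - ga * (x 1 * y 2 + x 2 * y 1)).
  by apply: R; rewrite !inE eqxx ?orbT.
have r6 : J (x 0 * y 3 + x 3 * y 0 - x 1 * y 2 + x 2 * y 1).
  by apply: R; rewrite !inE eqxx ?orbT.
have half e e' : J (2 * e) -> e' = e -> J e'.
  move=> H ->; apply: (@ideal_scalar _ _ io J idJ _ _ two0).
  by rewrite (_ : io 2 * e = 2 * e) //; ring.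
have [m10 m11 m12 m13] := minors_in_ideal idJ unimod4 r1 r2 r3 r4 r5 r6.
have unimod_cyc e : J (e * y 0) -> J (e * y 2) -> J (e * y 3) -> J (e * y 1) ->
    J e by move=> h0 h2 h3 h1; apply: unimod4.
have [m20 m22 m23 m21] := minors_in_ideal idJ unimod_cyc r3 r4 r5 r6 r1 r2.
have unimod_cyc2 e : J (e * y 0) -> J (e * y 3) -> J (e * y 1) -> J (e * y 2) ->
    J e by move=> h0 h3 h1 h2; apply: unimod4.
have [m30 m33 m31 m32] := minors_in_ideal idJ unimod_cyc2 r5 r6 r1 r2 r3 r4.
pose X m := x m ^+ 2.
have G0 : G (X 0 + X 1 + X 2 + X 3).
  apply: (orbit_in_colon (fibre_0 idJ two0 a0 b0 c0) _ _ (k1 := a ^+ 2)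
    (k2 := b ^+ 2) (k3 := c ^+ 2)).
  - by move=> t t_in; rewrite !mem_cat t_in ?orbT.
  - by apply: forall_ord4; rewrite mxE /= ?oppr_eq0 ?mulf_neq0 ?oner_eq0.
  - by rewrite !mxE /=; ring.
  - by rewrite !mxE /=; ring.
  - by rewrite !mxE /=; ring.
  - by apply: half m10 _; rewrite /X /al /be /ga; ring.
  - by apply: half m20 _; rewrite /X /al /be /ga; ring.
  - by apply: half m30 _; rewrite /X /al /be /ga; ring.
have G1 : G (X 0 - be * ga * X 1 - ga * X 2 + be * X 3).
  apply: (orbit_in_colon (fibre_1 idJ two0 hi a0) _ _ (k1 := - a ^+ 2)
    (k2 := -1) (k3 := 1)).
  - by move=> t t_in; rewrite !mem_cat t_in ?orbT.
  - by apply: forall_ord4; rewrite mxE /= ?oppr_eq0 ?mulf_neq0 ?oner_eq0.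
  - by rewrite !mxE /=; ring: hi.
  - by rewrite !mxE /=; ring: hi.
  - by rewrite !mxE /=; ring: hi.
  - by apply: half m11 _; rewrite /X /al /be /ga; ring.
  - by apply: half m21 _; rewrite /X /al /be /ga; ring.
  - by apply: half m31 _; rewrite /X /al /be /ga; ring.
have G2 : G (X 0 + ga * X 1 - ga * al * X 2 - al * X 3).
  apply: (orbit_in_colon (fibre_2 idJ two0 hi b0) _ _ (k1 := 1)
    (k2 := - b ^+ 2) (k3 := -1)).
  - by move=> t t_in; rewrite !mem_cat t_in ?orbT.
  - by apply: forall_ord4; rewrite mxE /= ?oppr_eq0 ?mulf_neq0 ?oner_eq0.
  - by rewrite !mxE /=; ring: hi.
  - by rewrite !mxE /=; ring: hi.
  - by rewrite !mxE /=; ring: hi.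
  - by apply: half m12 _; rewrite /X /al /be /ga; ring.
  - by apply: half m22 _; rewrite /X /al /be /ga; ring.
  - by apply: half m32 _; rewrite /X /al /be /ga; ring.
have G3 : G (X 0 - be * X 1 + al * X 2 - al * be * X 3).
  apply: (orbit_in_colon (fibre_3 idJ two0 hi c0) _ _ (k1 := -1)
    (k2 := 1) (k3 := - c ^+ 2)).
  - by move=> t t_in; rewrite !mem_cat t_in ?orbT.
  - by apply: forall_ord4; rewrite mxE /= ?oppr_eq0 ?mulf_neq0 ?oner_eq0.
  - by rewrite !mxE /=; ring: hi.
  - by rewrite !mxE /=; ring: hi.
  - by rewrite !mxE /=; ring: hi.
  - by apply: half m13 _; rewrite /X /al /be /ga; ring.
  - by apply: half m23 _; rewrite /X /al /be /ga; ring.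
  - by apply: half m33 _; rewrite /X /al /be /ga; ring.
apply: (@ideal_scalar _ _ io G idG _ _ delta0).
pose delta : A := io (a ^+ 2 + b ^+ 2 + c ^+ 2 + a ^+ 2 * b ^+ 2 * c ^+ 2).
have GX m : G (delta * X m).
  elim/forall_ord4: m.
  - apply: (ideal_sub idG (c := al * be * ga) G0); apply: (ideal_sub idG (c := al) G1).
    apply: (ideal_sub idG (c := be) G2); apply: (ideal_sub idG (c := ga) G3).
    by apply: ideal_eq0 => //; rewrite /delta /al /be /ga; ring.
  - apply: (ideal_sub idG (c := al) G0); apply: (ideal_sub idG (c := - al) G1).
    apply: (ideal_sub idG (c := 1) G2); apply: (ideal_sub idG (c := - 1) G3).
    by apply: ideal_eq0 => //; rewrite /delta /al /be /ga; ring.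
  - apply: (ideal_sub idG (c := be) G0); apply: (ideal_sub idG (c := - 1) G1).
    apply: (ideal_sub idG (c := - be) G2); apply: (ideal_sub idG (c := 1) G3).
    by apply: ideal_eq0 => //; rewrite /delta /al /be /ga; ring.
  - apply: (ideal_sub idG (c := ga) G0); apply: (ideal_sub idG (c := 1) G1).
    apply: (ideal_sub idG (c := - 1) G2); apply: (ideal_sub idG (c := - ga) G3).
    by apply: ideal_eq0 => //; rewrite /delta /al /be /ga; ring.
apply: (ideal_sub idG (c := 1) (GX p)); apply: JG.
apply: (ideal_sub idJ (c := - delta * (x p + 1)) xp1).
by apply: ideal_eq0 => //; rewrite /X /delta; ring.
Qed.

End ColonIdeal.

(** * The ideal of Gamma on a chart *)

Section Charts.

Variable k : fieldType.
Local Notation S := {mpoly k[4 + 4]}.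

Lemma ideal_gen_ideal (F : S -> Prop) : is_ideal (ideal_gen F).
Proof.
split=> [|e h f [s [Fs ->]] [t [Ft ->]]]; first by exists [::]; rewrite big_nil.
exists ([seq (e * u.1, u.2) | u <- s] ++ t); split=> [u|].
  by rewrite mem_cat => /orP[/mapP[u' /Fs Fu' ->] | /Ft].
by rewrite big_cat big_map /= mulr_sumr; congr (_ + _); apply: eq_bigr => u _;
  rewrite mulrA.
Qed.

Lemma ideal_gen_mem (F : S -> Prop) f : F f -> ideal_gen F f.
Proof.
move=> Ff; exists [:: (1, f)]; rewrite big_seq1 mul1r; split=> // u.
by rewrite inE => /eqP ->.
Qed.

Lemma ideal_gen_min (F J : S -> Prop) :
  is_ideal J -> (forall g, F g -> J g) -> forall f, ideal_gen F f -> J f.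
Proof.
move=> idJ FJ f [s [Fs ->]]; rewrite big_seq; apply: (ideal_sum idJ) => u us.
by apply: (idealM idJ); apply: FJ; apply: Fs.
Qed.

Lemma mpoly_alg_ind n (P : {mpoly k[n]} -> Prop) :
  (forall c, P c%:MP) -> (forall l, P 'X_l) ->
  (forall f g, P f -> P g -> P (f + g)) ->
  (forall f g, P f -> P g -> P (f * g)) -> forall f, P f.
Proof.
move=> PC PX PD PM; apply: mpolyind => [|c m f _ _ Pf].
  by rewrite -(mpolyC0 n); apply: (PC).
rewrite -mul_mpolyC mpolyXE_id; apply: PD => //; apply: (PM) => //.
elim/big_rec: _ => [|l g _ Pg]; first by rewrite -mpolyC1; apply: (PC).
apply: (PM) => //; elim: (m l) => [|d IHd]; first by rewrite expr0 -mpolyC1.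
by rewrite exprS; apply: (PM).
Qed.

(** Modulo an ideal, [h] times a polynomial is [h] times its value at a point
    as soon as this holds for the variables. *)
Lemma eval_mod_ideal n (J : {mpoly k[n]} -> Prop) h (z : 'I_n -> k) :
  is_ideal J -> (forall l, J (h * ('X_l - (z l)%:MP))) ->
  forall f, J (h * (f - (f.@[z])%:MP)).
Proof.
move=> idJ Jz; apply: mpoly_alg_ind => [e|l|f g Jf Jg|f g Jf Jg].
- by rewrite mevalC; apply: ideal_eq0 => //; ring.
- by rewrite mevalXU.
- rewrite mevalD mpolyCD; apply: (ideal_sub idJ (c := 1) Jf).
  by apply: (ideal_sub idJ (c := 1) Jg); apply: ideal_eq0 => //; ring.
- rewrite mevalM mpolyCM; apply: (ideal_sub idJ (c := g) Jf).
  apply: (ideal_sub idJ (c := (f.@[z])%:MP) Jg).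
  by apply: ideal_eq0 => //; ring.
Qed.

Variables (al be ga : k) (p q : 'I_4).

Lemma form11_is_linear : linear (@form11 k).
Proof.
move=> t u v; rewrite /form11 scaler_sumr -big_split; apply: eq_bigr => l _ /=.
rewrite scaler_sumr -big_split; apply: eq_bigr => m _ /=.
by rewrite !mxE scalerA -scalerDl.
Qed.

HB.instance Definition _ := GRing.isLinear.Build k 'M[k]_4 S _ (@form11 k)
  form11_is_linear.

Lemma form11_delta l m : form11 (delta_mx l m) = xvar k l * yvar k m.
Proof.
rewrite /form11 (bigD1 l) //= (bigD1 m) //= !mxE !eqxx scale1r.
rewrite big1 => [|m' ne]; last by rewrite mxE (negPf ne) andbF scale0r.
rewrite addr0 big1 ?addr0 // => l' ne; rewrite big1 // => m' _.
by rewrite mxE (negPf ne) scale0r.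
Qed.

Lemma form11_gens : map (@form11 k) (relation_gens al be ga) =
  rels al%:MP be%:MP ga%:MP (xvar k) (yvar k).
Proof.
have form11Z (e : k) (t : 'M[k]_4) : form11 (e *: t) = e%:MP * form11 t.
  by rewrite linearZ mul_mpolyC.
have form11D (t u : 'M[k]_4) : form11 (t + u) = form11 t + form11 u.
  exact: raddfD.
have form11N (t : 'M[k]_4) : form11 (- t) = - form11 t by exact: raddfN.
rewrite /= !form11D !form11N !form11Z !form11D !form11_delta /rels.
by congr [:: _; _; _; _; _; _]; ring.
Qed.

Lemma form11_relations (W : S -> Prop) :
  (forall r, r \in rels al%:MP be%:MP ga%:MP (xvar k) (yvar k) -> W r) ->
  (forall e f g, W f -> W g -> W (e *: f + g)) -> W 0 ->
  forall t, t \in relations al be ga -> W (form11 t).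
Proof.
move=> Wr Wlin W0 t; rewrite /relations => /coord_span ->; rewrite raddf_sum.
have Wgen l : (l < 6)%N -> W (form11 (relation_gens al be ga)`_l).
  by move=> lt_l; apply: Wr; rewrite -form11_gens; apply: map_f; rewrite mem_nth.
elim/big_rec: _ => [//|l f _ Wf].
move: (_`_l) (Wgen l (ltn_ord l)) => u Wu; move: (coord _ _ _) => e.
by rewrite /= linearZ; apply: (Wlin e).
Qed.

Lemma Gamma_ideal : is_ideal (Gamma al be ga p q).
Proof. exact: ideal_gen_ideal. Qed.

Lemma Gamma_solves :
  solves (Gamma al be ga p q) al%:MP be%:MP ga%:MP 1 (xvar k) (yvar k).
Proof.
move=> r; rewrite mul1r -form11_gens => /mapP[t t_gen ->].
apply: ideal_gen_mem; apply: Or31; exists t => //; exact: memv_span.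
Qed.

Definition dehomogenize (v w : 'rV[k]_4) : 'I_(4 + 4) -> k :=
  fun l => row_mx ((v 0 p)^-1 *: v) ((w 0 q)^-1 *: w) 0 l.

Definition vanishes_at (s : seq ('rV[k]_4 * 'rV[k]_4)) (f : S) : Prop :=
  forall v w, (v, w) \in s -> v 0 p != 0 -> w 0 q != 0 ->
    f.@[dehomogenize v w] = 0.

Lemma Gamma_vanishes (s : seq ('rV[k]_4 * 'rV[k]_4)) (f : S) :
  (forall v w, (v, w) \in s ->
     forall r, r \in rels al be ga (fun m => v 0 m) (fun m => w 0 m) -> r = 0) ->
  Gamma al be ga p q f -> vanishes_at s f.
Proof.
move=> Hs Gf v w vw vp wq.
have evx m : (xvar k m).@[dehomogenize v w] = (v 0 p)^-1 * v 0 m.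
  by rewrite mevalXU /dehomogenize row_mxEl mxE.
have evy m : (yvar k m).@[dehomogenize v w] = (w 0 q)^-1 * w 0 m.
  by rewrite mevalXU /dehomogenize row_mxEr mxE.
apply: (ideal_gen_min (J := fun g => g.@[dehomogenize v w] = 0)) Gf.
  split=> [|e g h g0 h0]; first by rewrite meval0.
  by rewrite mevalD mevalM g0 h0 mulr0 addr0.
move=> g [[t t_rel ->] | -> | ->]; last 2 first.
- by rewrite mevalB meval1 evx mulVf // subrr.
- by rewrite mevalB meval1 evy mulVf // subrr.
apply: (form11_relations (W := fun g => g.@[dehomogenize v w] = 0)) t_rel.
- move=> r /(nthP 0)[l lt_l <-].
  have := Hs v w vw _ (mem_nth 0 (lt_l : (l < size (rels al be ga _ _))%N)).
  move=> Hl; transitivity ((v 0 p)^-1 * (w 0 q)^-1 *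
    (rels al be ga (fun m => v 0 m) (fun m => w 0 m))`_l); last first.
    by rewrite Hl mulr0.
  by case: l lt_l {Hl} => [|[|[|[|[|[|//]]]]]] lt_l;
    rewrite /= !(mevalB, mevalD, mevalM, mevalC, evx, evy); ring.
- by move=> e f' g' f0 g0; rewrite mevalD mevalZ f0 g0 mulr0 addr0.
- by rewrite meval0.
Qed.

End Charts.

Section Reducedness.

Variables (k : fieldType) (i a b c : k).
Hypotheses (two0 : (2 : k) != 0) (hi : i ^+ 2 = -1).
Hypotheses (a0 : a != 0) (b0 : b != 0) (c0 : c != 0).
Hypothesis delta0 :
  a ^+ 2 + b ^+ 2 + c ^+ 2 + a ^+ 2 * b ^+ 2 * c ^+ 2 != 0.
Variables p q : 'I_4.

Local Notation S := {mpoly k[4 + 4]}.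
Let J : S -> Prop := Gamma (a ^+ 2) (b ^+ 2) (c ^+ 2) p q.
Let idJ : is_ideal J := Gamma_ideal _ _ _ p q.

(** A point off the chart contributes nothing: there [h] itself is in the
    ideal. *)
Lemma proportional_chart h (z : 'I_4 -> S) (v : 'rV[k]_4) m :
  J (z m - 1) -> v != 0 -> proportional J h z (emb (@mpolyC _ k) v) ->
  v 0 m = 0 /\ J h \/
  v 0 m != 0 /\ forall l, J (h * (z l - ((v 0 m)^-1 * v 0 l)%:MP)).
Proof.
move=> zm v0 prop; case: (eqVneq (v 0 m) 0) => [vm | vm]; [left | right].
  split=> //; have [l vl] : exists l, v 0 l != 0.
    by apply/existsP; apply: contraNT v0 => /existsPn v0; apply/eqP/rowP => l;
      rewrite mxE; apply/eqP; move: (v0 l); rewrite negbK.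
  apply: (@ideal_scalar _ _ (@mpolyC _ k) J idJ _ _ vl).
  apply: (ideal_sub idJ (c := -1) (prop l m)).
  apply: (ideal_sub idJ (c := - h * (v 0 l)%:MP) zm).
  by apply: ideal_eq0 => //; rewrite /emb vm rmorph0; ring.
split=> // l; apply: (@ideal_scalar _ _ (@mpolyC _ k) J idJ _ _ vm).
apply: (ideal_sub idJ (c := 1) (prop l m)).
apply: (ideal_sub idJ (c := h * (v 0 l)%:MP) zm).
apply: ideal_eq0 => //; rewrite /emb /=.
have e : (v 0 m)%:MP * (v 0 m)^-1%:MP = 1 :> S by rewrite -mpolyCM mulfV ?mpolyC1.
by ring: e.
Qed.

Lemma Gamma_reduced f :
  (forall v w, (v, w) \in graph_pairs i a b c -> (v != 0) && (w != 0)) ->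
  vanishes_at p q (graph_pairs i a b c) f -> J f.
Proof.
move=> nz0 f0; pose G g := J (g * f).
have idG : is_ideal G.
  split=> [|e h g Gh Gg]; rewrite /G; first by rewrite mul0r; apply: idJ.1.
  by rewrite mulrDl -mulrA; apply: idJ.2.
have JG e : J e -> G e by move=> Je; rewrite /G mulrC; apply: idealM.
have xp1 : J (xvar k p - 1) by apply: ideal_gen_mem; apply: Or32.
have yq1 : J (yvar k q - 1) by apply: ideal_gen_mem; apply: Or33.
have leaf h v w : (v, w) \in graph_pairs i a b c ->
    proportional J h (xvar k) (emb (@mpolyC _ k) v) ->
    proportional J h (yvar k) (emb (@mpolyC _ k) w) -> G h.
  move=> vw Px Py; have /andP[v0 w0] := nz0 v w vw.
  have [[_ /JG //]|[vp Hx]] := proportional_chart xp1 v0 Px.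
  have [[_ /JG //]|[wq Hy]] := proportional_chart yq1 w0 Py.
  have := eval_mod_ideal (h := h) (z := dehomogenize p q v w) idJ _ f.
  rewrite f0 // mpolyC0 subr0; apply => l.
  rewrite /dehomogenize -[l]splitK; case: (split l) => m /=.
    by rewrite row_mxEl mxE; apply: Hx.
  by rewrite row_mxEr mxE; apply: Hy.
have := one_in_colon idJ idG JG two0 hi a0 b0 c0 xp1 yq1
  (@Gamma_solves _ (a ^+ 2) (b ^+ 2) (c ^+ 2) p q) leaf delta0.
by rewrite /G mul1r.
Qed.

End Reducedness.

(** * The graph of theta *)

Section Lines.

Variable k : fieldType.
Hypothesis two0 : (2 : k) != 0.
Local Notation row4 := 'rV[k]_4.

Lemma line_cross (v w : row4) :
  (<[v]> = <[w]>)%VS -> forall l m, v 0 l * w 0 m = v 0 m * w 0 l.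
Proof.
move=> vw l m; have : v \in <[w]>%VS by rewrite -vw memv_line.
by case/vlineP => t ->; rewrite !mxE; ring.
Qed.

Definition orbit_lines (u : row4) : seq (point k) :=
  [seq <[twist_row s u]>%VS | s <- signs k].

Definition coord_lines : seq (point k) :=
  [seq <[coord_row k m]>%VS | m <- [:: 0; 1; 2; 3]].

Definition torus (u : row4) : Prop := forall m, u 0 m != 0.

(** The ratios [u0 u1 / u2 u3], [u0 u2 / u3 u1], [u0 u3 / u1 u2] are invariant
    under the sign changes; they tell orbits apart. *)
Definition separated (u v : row4) : bool :=
  [|| u 0 0 * u 0 1 * (v 0 2 * v 0 3) != v 0 0 * v 0 1 * (u 0 2 * u 0 3),
      u 0 0 * u 0 2 * (v 0 3 * v 0 1) != v 0 0 * v 0 2 * (u 0 3 * u 0 1)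
    | u 0 0 * u 0 3 * (v 0 1 * v 0 2) != v 0 0 * v 0 3 * (u 0 1 * u 0 2)].

Lemma orbit_lines_disjoint u v :
  separated u v -> ~~ has (mem (orbit_lines u)) (orbit_lines v).
Proof.
apply: contraL => /hasP[_ /mapP[s s_in ->] /mapP[t t_in]] /= /esym tusv.
have /vlineP[e /rowP E] : twist_row t u \in <[twist_row s v]>%VS.
  by rewrite -tusv memv_line.
have sgn r : r \in signs k -> [/\ r`_0 = 1, r`_1 * r`_1 = 1, r`_2 * r`_2 = 1
    & r`_3 = r`_1 * r`_2].
  by rewrite !inE; case/or4P => /eqP -> /=; split => //; ring.
have [s0 s1 s2 s3] := sgn s s_in; have [t0 t1 t2 t3] := sgn t t_in.
have := E 0; have := E 1; have := E 2; have := E 3.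
rewrite !mxE /= s0 s3 t0 t3 !mul1r => e3 e2 e1 e0.
have f0 : u 0 0 = e * v 0 0 by [].
have f1 : u 0 1 = e * t`_1 * s`_1 * v 0 1 by rewrite -[LHS]mul1r -t1; ring: e1.
have f2 : u 0 2 = e * t`_2 * s`_2 * v 0 2 by rewrite -[LHS]mul1r -t2; ring: e2.
have f3 : u 0 3 = e * (t`_1 * t`_2) * (s`_1 * s`_2) * v 0 3.
  by rewrite -[LHS]mul1r -[X in X * _]mulr1 -{1}t1 -t2; ring: e3.
rewrite /separated f0 f1 f2 f3; move: t1 t2 s1 s2 {e0 e1 e2 e3 f0 f1 f2 f3 E}.
move: s`_1 s`_2 t`_1 t`_2 => x1 x2 y1 y2 h1 h2 h3 h4.
rewrite !negb_or !negbK; apply/and3P; split; apply/eqP; ring: h1 h2 h3 h4.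
Qed.

Lemma orbit_lines_coord u :
  torus u -> ~~ has (mem coord_lines) (orbit_lines u).
Proof.
move=> u0; apply/hasPn => _ /mapP[s s_in ->]; apply/negP => /mapP[m _].
move/line_cross => cross.
have [l lm] : exists l : 'I_4, l != m.
  by elim/forall_ord4: m {cross}; [exists 1 | exists 0 | exists 0 | exists 0].
have s0 : s`_l != 0.
  by elim/forall_ord4: l {lm}; move: s_in; rewrite !inE;
    case/or4P => /eqP -> /=; rewrite ?oppr_eq0 oner_eq0.
have := cross l m; rewrite !mxE eqxx (negPf lm) mulr1 mulr0 => /eqP.
by rewrite mulf_eq0 (negPf s0) (negPf (u0 l)).
Qed.

Lemma coord_lines_uniq : uniq coord_lines.
Proof.
rewrite map_inj_in_uniq // => m l _ _ /line_cross cross.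
apply/eqP; apply: contraT => ml; have := cross m l; rewrite !mxE !eqxx.
by rewrite eq_sym (negPf ml) mulr1 mulr0 => /eqP; rewrite oner_eq0.
Qed.

Lemma orbit_lines_uniq u : torus u -> uniq (orbit_lines u).
Proof.
move=> u0; rewrite map_inj_in_uniq => [|s t s_in t_in /line_cross cross].
  rewrite /signs /= !inE !eqseq_cons !eqxx /= ?andbT ?andbF.
  have n1 : (1 == -1 :> k) = false.
    by apply/negbTE; rewrite -subr_eq0 opprK.
  by rewrite !(eq_sym (-1)) !n1.
have sgn r : r \in signs k -> r`_0 = 1 /\ size r = 4%N.
  by rewrite !inE; case/or4P => /eqP ->.
have [[s0 size_s] [t0 size_t]] := (sgn s s_in, sgn t t_in).
apply: (eq_from_nth (x0 := 0)) => [|m]; rewrite size_s ?size_t // => lt_m.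
have := cross 0 (Ordinal lt_m); rewrite !mxE /= s0 t0 !mul1r => e.
apply: (mulfI (u0 0)); apply: (mulfI (u0 (Ordinal lt_m))); ring: e.
Qed.

End Lines.

Lemma mem_fset4 (T : choiceType) (x y z t : T) :
  [fset x; y; z; t] =i [:: x; y; z; t].
Proof. by move=> u; rewrite !inE -!orbA. Qed.

Lemma uniq_cat5 (T : eqType) (s0 s1 s2 s3 s4 : seq T) :
  [&& uniq s0, uniq s1, uniq s2, uniq s3 & uniq s4] ->
  [&& ~~ has (mem s0) s1, ~~ has (mem s0) s2, ~~ has (mem s0) s3
    & ~~ has (mem s0) s4] ->
  [&& ~~ has (mem s1) s2, ~~ has (mem s1) s3, ~~ has (mem s1) s4,
      ~~ has (mem s2) s3, ~~ has (mem s2) s4 & ~~ has (mem s3) s4] ->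
  uniq (s0 ++ s1 ++ s2 ++ s3 ++ s4).
Proof.
move=> /and5P[u0 u1 u2 u3 u4] /and4P[d1 d2 d3 d4].
move=> /and5P[d12 d13 d14 d23 /andP[d24 d34]].
rewrite !cat_uniq !has_cat !negb_or.
by rewrite u0 u1 u2 u3 u4 d1 d2 d3 d4 d12 d13 d14 d23 d24 d34.
Qed.

Lemma mem_fsetU_cat (T : choiceType) (A0 A1 A2 A3 A4 : {fset T})
    (s0 s1 s2 s3 s4 : seq T) :
  A0 =i s0 -> A1 =i s1 -> A2 =i s2 -> A3 =i s3 -> A4 =i s4 ->
  A0 `|` A1 `|` A2 `|` A3 `|` A4 =i s0 ++ s1 ++ s2 ++ s3 ++ s4.
Proof.
by move=> e0 e1 e2 e3 e4 x; rewrite !in_fsetU !mem_cat e0 e1 e2 e3 e4 -!orbA.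
Qed.

Lemma card_fset_seq (T : choiceType) (A : {fset T}) (s : seq T) :
  A =i s -> uniq s -> #|` A| = size s.
Proof.
move=> As us.
by apply: perm_size; apply: uniq_perm => //; exact: fset_uniq.
Qed.

Lemma mem_imfset_seq (T U : choiceType) (f : T -> U) (A : {fset T}) (s : seq T) :
  A =i s -> [fset f x | x in A] =i map f s.
Proof.
move=> As u; apply/imfsetP/mapP => -[x /= xA ->]; exists x => //.
  by rewrite -As.
by rewrite As.
Qed.

Section Theta.

Variables (k : fieldType) (i a b c : k).
Hypotheses (two0 : (2 : k) != 0) (hi : i ^+ 2 = -1).
Hypotheses (a0 : a != 0) (b0 : b != 0) (c0 : c != 0).

Let i0 : i != 0.
Proof.
by apply/eqP => i0; move/eqP: hi; rewrite i0 expr0n eq_sym oppr_eq0 oner_eq0.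
Qed.

Local Notation u0 := (vec4 (a * b * c) a b c).
Local Notation u1 := (vec4 a (- (i * a)) (- i) (- 1)).
Local Notation u2 := (vec4 b (- 1) (- (i * b)) (- i)).
Local Notation u3 := (vec4 c (- i) (- 1) (- (i * c))).
Local Notation w0 := (vec4 (- (a * b * c)) a b c).
Local Notation w1 := (vec4 (- a) (- (i * a)) i 1).
Local Notation w2 := (vec4 (- b) 1 (- (i * b)) i).
Local Notation w3 := (vec4 (- c) i 1 (- (i * c))).

Lemma coord_linesE : coord_lines k =
  [:: pt 1 0 0 0; pt 0 1 0 0; pt 0 0 1 0; pt 0 0 0 1].
Proof.
rewrite /coord_lines /= /pt.
by congr [:: _; _; _; _]; congr <[_]>%VS; apply/rowP; apply: forall_ord4;
  rewrite !mxE.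
Qed.

Lemma orbit_linesE (x0 x1 x2 x3 : k) : orbit_lines (vec4 x0 x1 x2 x3) =
  [:: pt x0 x1 x2 x3; pt x0 x1 (- x2) (- x3);
      pt x0 (- x1) x2 (- x3); pt x0 (- x1) (- x2) x3].
Proof.
rewrite /orbit_lines /= /pt.
by congr [:: _; _; _; _]; congr <[_]>%VS; apply/rowP; apply: forall_ord4;
  rewrite !mxE /= ?mul1r ?mulN1r.
Qed.

Lemma P_infE : P_inf k =i coord_lines k.
Proof. by move=> P; rewrite coord_linesE mem_fset4. Qed.

Lemma P_0E : P_0 a b c =i orbit_lines u0.
Proof. by move=> P; rewrite orbit_linesE mem_fset4. Qed.

Lemma P_1E : P_1 i a =i orbit_lines u1.
Proof. by move=> P; rewrite orbit_linesE !opprK mem_fset4. Qed.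

Lemma P_2E : P_2 i b =i orbit_lines u2.
Proof. by move=> P; rewrite orbit_linesE !opprK mem_fset4. Qed.

Lemma P_3E : P_3 i c =i orbit_lines u3.
Proof. by move=> P; rewrite orbit_linesE !opprK mem_fset4. Qed.

Lemma scale_line (d0 d1 d2 d3 : k) (v : 'rV[k]_4) :
  scale_coords d0 d1 d2 d3 <[v]>%VS = <[twist_row [:: d0; d1; d2; d3] v]>%VS.
Proof.
rewrite /scale_coords limg_line lfunE /=; congr <[_]>%VS; apply/rowP => m.
by rewrite mul_mx_diag !mxE mulrC.
Qed.

Lemma twist_twist (s t : seq k) (v : 'rV[k]_4) :
  twist_row s (twist_row t v) = twist_row t (twist_row s v).
Proof. by apply/rowP => m; rewrite !mxE; ring. Qed.

Lemma ominus_orbit (s : seq k) (x0 x1 x2 x3 : k) :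
  ominus <[twist_row s (vec4 x0 x1 x2 x3)]>%VS =
  <[twist_row s (vec4 (- x0) x1 x2 x3)]>%VS.
Proof.
rewrite /ominus scale_line twist_twist; congr (@vline k _ (twist_row s _)).
by apply/rowP; apply: forall_ord4; rewrite !mxE /= ?mul1r ?mulN1r.
Qed.

Lemma gamma_orbit (d1 d2 d3 : k) (s : seq k) (x0 x1 x2 x3 : k) :
  scale_coords 1 d1 d2 d3 <[twist_row s (vec4 x0 x1 x2 x3)]>%VS =
  <[twist_row s (vec4 x0 (d1 * x1) (d2 * x2) (d3 * x3))]>%VS.
Proof.
rewrite scale_line twist_twist; congr (@vline k _ (twist_row s _)).
by apply/rowP; apply: forall_ord4; rewrite !mxE /= ?mul1r.
Qed.

Lemma torus_vec4 (x0 x1 x2 x3 : k) :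
  x0 != 0 -> x1 != 0 -> x2 != 0 -> x3 != 0 -> torus (vec4 x0 x1 x2 x3).
Proof. by move=> *; apply: forall_ord4; rewrite mxE. Qed.

Lemma uniq_lines (v0 v1 v2 v3 : 'rV[k]_4) :
  torus v0 -> torus v1 -> torus v2 -> torus v3 ->
  [&& separated v0 v1, separated v0 v2, separated v0 v3, separated v1 v2,
      separated v1 v3 & separated v2 v3] ->
  uniq (coord_lines k ++ orbit_lines v0 ++ orbit_lines v1 ++ orbit_lines v2
        ++ orbit_lines v3).
Proof.
move=> t0 t1 t2 t3 /and5P[s01 s02 s03 s12 /andP[s13 s23]].
have [[[q0 q1] q2] q3] := (orbit_lines_coord t0, orbit_lines_coord t1,
  orbit_lines_coord t2, orbit_lines_coord t3).
have [[d01 d02] d03] := (orbit_lines_disjoint s01, orbit_lines_disjoint s02,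
  orbit_lines_disjoint s03).
have [[d12 d13] d23] := (orbit_lines_disjoint s12, orbit_lines_disjoint s13,
  orbit_lines_disjoint s23).
have [[[o0 o1] o2] o3] := (orbit_lines_uniq two0 t0, orbit_lines_uniq two0 t1,
  orbit_lines_uniq two0 t2, orbit_lines_uniq two0 t3).
apply: uniq_cat5.
- by apply/and5P; split; [exact: coord_lines_uniq | exact: o0 | exact: o1
    | exact: o2 | exact: o3].
- by apply/and4P; split; [exact: q0 | exact: q1 | exact: q2 | exact: q3].
- by apply/and5P; split; [exact: d01 | exact: d02 | exact: d03 | exact: d12
    | apply/andP; split; [exact: d13 | exact: d23]].
Qed.

Lemma torus_u : [/\ torus u0, torus u1, torus u2 & torus u3].
Proof.
by split; apply: torus_vec4; rewrite ?oppr_eq0 ?mulf_neq0 ?oner_eq0.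
Qed.

Lemma torus_w : [/\ torus w0, torus w1, torus w2 & torus w3].
Proof.
by split; apply: torus_vec4; rewrite ?oppr_eq0 ?mulf_neq0 ?oner_eq0.
Qed.

Lemma separated_u :
  [&& separated u0 u1, separated u0 u2, separated u0 u3, separated u1 u2,
      separated u1 u3 & separated u2 u3].
Proof.
have nz := (oppr_eq0, mulf_neq0, expf_neq0); rewrite /separated !mxE /=.
apply/and5P; split; last (apply/andP; split); apply/or3P;
  [apply: Or31 | apply: Or32 | apply: Or33 | apply: Or33 | apply: Or32
  | apply: Or31]; rewrite -subr_eq0.
- by rewrite [X in X != 0](_ : _ = 2 * i * a ^+ 2 * b * c) ?nz //; ring: hi.
- by rewrite [X in X != 0](_ : _ = 2 * i * a * b ^+ 2 * c) ?nz //; ring: hi.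
- by rewrite [X in X != 0](_ : _ = 2 * i * a * b * c ^+ 2) ?nz //; ring: hi.
- by rewrite [X in X != 0](_ : _ = - 2 * i * a * b) ?nz //; ring: hi.
- by rewrite [X in X != 0](_ : _ = 2 * i * a * c) ?nz //; ring: hi.
- by rewrite [X in X != 0](_ : _ = - 2 * i * b * c) ?nz //; ring: hi.
Qed.

Lemma separated_w :
  [&& separated w0 w1, separated w0 w2, separated w0 w3, separated w1 w2,
      separated w1 w3 & separated w2 w3].
Proof.
have nz := (oppr_eq0, mulf_neq0, expf_neq0); rewrite /separated !mxE /=.
apply/and5P; split; last (apply/andP; split); apply/or3P;
  [apply: Or31 | apply: Or32 | apply: Or33 | apply: Or33 | apply: Or32
  | apply: Or31]; rewrite -subr_eq0.
- by rewrite [X in X != 0](_ : _ = - 2 * i * a ^+ 2 * b * c) ?nz //; ring: hi.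
- by rewrite [X in X != 0](_ : _ = - 2 * i * a * b ^+ 2 * c) ?nz //; ring: hi.
- by rewrite [X in X != 0](_ : _ = - 2 * i * a * b * c ^+ 2) ?nz //; ring: hi.
- by rewrite [X in X != 0](_ : _ = 2 * i * a * b) ?nz //; ring: hi.
- by rewrite [X in X != 0](_ : _ = - 2 * i * a * c) ?nz //; ring: hi.
- by rewrite [X in X != 0](_ : _ = 2 * i * b * c) ?nz //; ring: hi.
Qed.

Local Notation sources :=
  (map (fun vw : 'rV[k]_4 * 'rV[k]_4 => <[vw.1]>%VS) (graph_pairs i a b c)).
Local Notation targets :=
  (map (fun vw : 'rV[k]_4 * 'rV[k]_4 => <[vw.2]>%VS) (graph_pairs i a b c)).

Lemma sourcesE : sources = coord_lines k ++ orbit_lines u0 ++ orbit_lines u1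
  ++ orbit_lines u2 ++ orbit_lines u3.
Proof. by rewrite /graph_pairs !map_cat /orbit_pairs -!map_comp. Qed.

Lemma targetsE : targets = coord_lines k ++ orbit_lines w0 ++ orbit_lines w1
  ++ orbit_lines w2 ++ orbit_lines w3.
Proof. by rewrite /graph_pairs !map_cat /orbit_pairs -!map_comp. Qed.

Lemma sources_uniq : uniq sources.
Proof.
have [t0 t1 t2 t3] := torus_u.
by rewrite sourcesE; apply: uniq_lines separated_u.
Qed.

Lemma targets_uniq : uniq targets.
Proof.
have [t0 t1 t2 t3] := torus_w.
by rewrite targetsE; apply: uniq_lines separated_w.
Qed.

Lemma PP_sources : PP i a b c =i sources.
Proof.
rewrite sourcesE; apply: mem_fsetU_cat;
  [exact: P_infE | exact: P_0E | exact: P_1E | exact: P_2E | exact: P_3E].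
Qed.

Lemma theta_pairs v w : (v, w) \in graph_pairs i a b c ->
  theta i a b c <[v]>%VS = <[w]>%VS.
Proof.
have [t0 t1 t2 t3] := torus_u.
have [[[d0 d1] d2] d3] := (orbit_lines_coord t0, orbit_lines_coord t1,
  orbit_lines_coord t2, orbit_lines_coord t3).
have /and5P[s01 s02 s03 s12 /andP[s13 s23]] := separated_u.
have [[d01 d02] d03] := (orbit_lines_disjoint s01, orbit_lines_disjoint s02,
  orbit_lines_disjoint s03).
have [[d12 d13] d23] := (orbit_lines_disjoint s12, orbit_lines_disjoint s13,
  orbit_lines_disjoint s23).
have notin (A : {fset point k}) (s1 s2 : seq (point k)) P : A =i s1 ->
    ~~ has (mem s1) s2 -> P \in s2 -> (P \in A) = false.
  by move=> As1 /hasPn d /d; rewrite As1 => /negbTE.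
have isin (A : {fset point k}) (s1 : seq (point k)) P :
    A =i s1 -> P \in s1 -> P \in A by move=> ->.
rewrite /graph_pairs !mem_cat => /or4P[|||/orP[]] /mapP[s s_in [-> ->]].
- have P_in := map_f (fun m => <[coord_row k m]>%VS) s_in.
  by rewrite /theta ifT //; apply: isin P_infE P_in.
- have P_in := map_f (fun s => <[twist_row s u0]>%VS) s_in.
  rewrite /theta (@ifF _ _ _ _ (notin _ _ _ _ P_infE d0 P_in)).
  rewrite (@ifT _ _ _ _ (isin _ _ _ P_0E P_in)).
  by rewrite ominus_orbit.
- have P_in := map_f (fun s => <[twist_row s u1]>%VS) s_in.
  rewrite /theta (@ifF _ _ _ _ (notin _ _ _ _ P_infE d1 P_in)).
  rewrite (@ifF _ _ _ _ (notin _ _ _ _ P_0E d01 P_in)).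
  rewrite (@ifT _ _ _ _ (isin _ _ _ P_1E P_in)).
  by rewrite /gamma1 gamma_orbit ominus_orbit !mulN1r !opprK mul1r.
- have P_in := map_f (fun s => <[twist_row s u2]>%VS) s_in.
  rewrite /theta (@ifF _ _ _ _ (notin _ _ _ _ P_infE d2 P_in)).
  rewrite (@ifF _ _ _ _ (notin _ _ _ _ P_0E d02 P_in)).
  rewrite (@ifF _ _ _ _ (notin _ _ _ _ P_1E d12 P_in)).
  rewrite (@ifT _ _ _ _ (isin _ _ _ P_2E P_in)).
  by rewrite /gamma2 gamma_orbit ominus_orbit !mulN1r !opprK mul1r.
- have P_in := map_f (fun s => <[twist_row s u3]>%VS) s_in.
  rewrite /theta (@ifF _ _ _ _ (notin _ _ _ _ P_infE d3 P_in)).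
  rewrite (@ifF _ _ _ _ (notin _ _ _ _ P_0E d03 P_in)).
  rewrite (@ifF _ _ _ _ (notin _ _ _ _ P_1E d13 P_in)).
  rewrite (@ifF _ _ _ _ (notin _ _ _ _ P_2E d23 P_in)).
  by rewrite /gamma3 gamma_orbit ominus_orbit !mulN1r !opprK mul1r.
Qed.

Lemma mem_theta_graph P Q : (P, Q) \in theta_graph i a b c <->
  exists v w, [/\ (v, w) \in graph_pairs i a b c, P = <[v]>%VS & Q = <[w]>%VS].
Proof.
split=> [/imfsetP[/= P' P'_in [-> ->]] | [v [w [vw -> ->]]]].
  move: P'_in; rewrite PP_sources => /mapP[[v w] vw ->].
  by exists v, w; split=> //; apply: theta_pairs.
rewrite -(theta_pairs vw); apply/imfsetP; exists <[v]>%VS => //=.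
by rewrite PP_sources; apply/mapP; exists (v, w).
Qed.

Lemma theta_inj : {in PP i a b c &, injective (theta i a b c)}.
Proof.
move=> P Q; rewrite !PP_sources => /mapP[[v w] vw ->] /mapP[[v' w'] vw' ->] /=.
rewrite (theta_pairs vw) (theta_pairs vw') => ww'.
have [n lt_n e] := nthP (0, 0) vw; have [m lt_m e'] := nthP (0, 0) vw'.
have := nth_uniq 0%VS _ _ targets_uniq; rewrite !size_map => /(_ n m lt_n lt_m).
rewrite !(nth_map (0, 0)) // e e' /= ww' eqxx => /esym /eqP nm.
by move: e; rewrite nm e' => -[->].
Qed.

Lemma vlineN (v : 'rV[k]_4) : <[- v]>%VS = <[v]>%VS.
Proof.
apply: subv_anti; apply/andP; split.
  by rewrite -memvE memvN memv_line.
by rewrite -memvE -[X in X \in _]opprK memvN memv_line.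
Qed.

Lemma ominus_coord : map (@ominus k) (coord_lines k) = coord_lines k.
Proof.
rewrite /coord_lines -map_comp; apply: eq_map => m /=.
rewrite /ominus scale_line; case: (eqVneq m 0) => [-> | m0].
  rewrite -vlineN; congr (@vline k _ _); apply/rowP.
  by apply: forall_ord4; rewrite !mxE /= ?mulr0 ?mulN1r ?opprK ?oppr0.
congr (@vline k _ _); apply/rowP => l; rewrite !mxE.
case: (eqVneq l m) => [-> | _]; last by rewrite mulr0.
by elim/forall_ord4: m m0 => //=; rewrite mulr1.
Qed.

Lemma ominus_orbit_lines (x0 x1 x2 x3 : k) :
  map (@ominus k) (orbit_lines (vec4 x0 x1 x2 x3)) =
  orbit_lines (vec4 (- x0) x1 x2 x3).
Proof.
by rewrite /orbit_lines -map_comp; apply: eq_map => s /=; apply: ominus_orbit.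
Qed.

(** The base points of the images under [theta] differ from the images of the
    base points under [ominus] by a sign change, which permutes the orbit. *)
Lemma orbit_lines_perm (x0 x1 x2 x3 : k) :
  [/\ orbit_lines (vec4 x0 x1 (- x2) (- x3)) =i orbit_lines (vec4 x0 x1 x2 x3),
      orbit_lines (vec4 x0 (- x1) x2 (- x3)) =i orbit_lines (vec4 x0 x1 x2 x3)
    & orbit_lines (vec4 x0 (- x1) (- x2) x3) =i orbit_lines (vec4 x0 x1 x2 x3)].
Proof.
have swap (T : eqType) (x y z t : T) :
    [/\ [:: y; x; t; z] =i [:: x; y; z; t], [:: z; t; x; y] =i [:: x; y; z; t]
      & [:: t; z; y; x] =i [:: x; y; z; t]].
  by split=> u; rewrite !inE; do 4 case: (u == _).
rewrite !orbit_linesE !opprK.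
by case: (swap _ (pt x0 x1 x2 x3) (pt x0 x1 (- x2) (- x3))
  (pt x0 (- x1) x2 (- x3)) (pt x0 (- x1) (- x2) x3)).
Qed.

Lemma eq_mem_cat5 (T : eqType) (s0 s1 s2 s3 s4 t0 t1 t2 t3 t4 : seq T) :
  s0 =i t0 -> s1 =i t1 -> s2 =i t2 -> s3 =i t3 -> s4 =i t4 ->
  s0 ++ s1 ++ s2 ++ s3 ++ s4 =i t0 ++ t1 ++ t2 ++ t3 ++ t4.
Proof. by move=> e0 e1 e2 e3 e4 x; rewrite !mem_cat e0 e1 e2 e3 e4. Qed.

Lemma theta_image : [fset theta i a b c P | P in PP i a b c] = ominusPP i a b c.
Proof.
have map_theta : map (theta i a b c) sources = targets.
  by rewrite -map_comp; apply/eq_in_map => -[v w] vw /=; apply: theta_pairs.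
apply/fsetP => Q.
rewrite (mem_imfset_seq (theta i a b c) PP_sources) map_theta.
rewrite (mem_imfset_seq (@ominus k) PP_sources) sourcesE targetsE !map_cat.
move: Q; apply: eq_mem_cat5 => [||||] Q.
- by rewrite ominus_coord.
- by rewrite ominus_orbit_lines.
- rewrite ominus_orbit_lines.
  have [+ _ _] := orbit_lines_perm (- a) (- (i * a)) (- i) (- 1).
  by rewrite !opprK.
- rewrite ominus_orbit_lines.
  have [_ + _] := orbit_lines_perm (- b) (- 1) (- (i * b)) (- i).
  by rewrite !opprK.
- rewrite ominus_orbit_lines.
  have [_ _ +] := orbit_lines_perm (- c) (- i) (- 1) (- (i * c)).
  by rewrite !opprK.
Qed.

Lemma card_theta_graph : #|` theta_graph i a b c| = 20%N.
Proof.
rewrite card_imfset; last by move=> P Q [].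
by rewrite (card_fset_seq PP_sources sources_uniq) !size_map.
Qed.

End Theta.

(** * Curves on Gamma *)

Section Jets.

Variable k : fieldType.
Local Notation S := {mpoly k[4 + 4]}.

Definition jet (x y : 'I_4 -> {poly k}) (f : S) : {poly k} :=
  mmap (@polyC k) (fun l => match split l with inl m => x m | inr m => y m end) f.

Lemma jet_x x y m : jet x y (xvar k m) = x m.
Proof.
rewrite /jet mmapX mmap1U; case: splitP => m' /= e.
  by congr x; apply: val_inj.
by move: (ltn_ord m); rewrite e ltnNge leq_addr.
Qed.

Lemma jet_y x y m : jet x y (yvar k m) = y m.
Proof.
rewrite /jet mmapX mmap1U; case: splitP => m' /= e.
  by move: (ltn_ord m'); rewrite -e ltnNge leq_addr.
by congr y; apply: val_inj; apply: (@addnI 4).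
Qed.

Lemma jetD x y : {morph jet x y : f g / f + g}. Proof. exact: mmapD. Qed.
Lemma jetB x y : {morph jet x y : f g / f - g}. Proof. exact: mmapB. Qed.
Lemma jetM x y : {morph jet x y : f g / f * g}. Proof. exact: rmorphM. Qed.
Lemma jetC x y e : jet x y e%:MP = e%:P. Proof. exact: mmapC. Qed.
Lemma jet1 x y : jet x y 1 = 1. Proof. exact: rmorph1. Qed.
Lemma jetXn x y f n : jet x y (f ^+ n) = jet x y f ^+ n.
Proof. exact: rmorphXn. Qed.

Lemma dvd_ideal (d : {poly k}) : is_ideal (fun g => d %| g).
Proof.
split=> [|e g h dg dh]; first exact: dvdp0.
by apply: dvdp_add => //; apply: dvdp_mull.
Qed.

(** If the subscheme contains, for every [N], the image of the [N]-jet of a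
    curve along which some function has a simple zero, then the powers of that
    function are linearly independent. *)
Lemma jets_not_finite (Z : subscheme k) p q :
  (forall N, exists x y,
     (forall f, Z p q f -> 'X^N %| jet x y f) /\
     exists f, (jet x y f)`_0 = 0 /\ ((1 < N)%N -> (jet x y f)`_1 != 0)) ->
  ~ finite_subscheme Z.
Proof.
move=> jets /(_ p q) [e He]; pose N := (size e).+2.
have [x [y [Zxy [f [f0 /(_ isT) f1]]]]] := jets N.
have [g fg] : exists g, jet x y f = 'X * g.
  have /polyXsubCP : (jet x y f).[0] = 0 by rewrite horner_coef0.
  by rewrite subr0 => /dvdpP[g ->]; exists g; rewrite mulrC.
have g0 : g`_0 != 0 by move: f1; rewrite fg coefXM.
have powE n : jet x y (f ^+ n) = 'X^n * g ^+ n by rewrite jetXn fg exprMn.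
pose M : 'M[k]_N := \matrix_(l, n) (jet x y (f ^+ n))`_l.
have Munit : M \in unitmx.
  rewrite unitmxE unitfE det_trig; last first.
    by apply/is_trig_mxP => l n lt_ln; rewrite mxE powE coefXnM lt_ln.
  apply/prodf_neq0 => n _; rewrite mxE powE coefXnM ltnn subnn.
  rewrite -horner_coef0 horner_exp expf_neq0 // horner_coef0 //.
have [u Hu] := fin_all_exists (fun n : 'I_N => He (f ^+ n)).
have ME : M = (\matrix_(l < N, m < size e) (jet x y e`_m)`_l) *m
              (\matrix_(m < size e, n < N) u n m).
  apply/matrixP => l n; rewrite !mxE.
  have /dvdpP[h /(congr1 (fun P : {poly k} => P`_l))] := Zxy _ (Hu n).
  rewrite coefMXn ltn_ord jetB coefB => /eqP; rewrite subr_eq0 => /eqP ->.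
  rewrite /jet raddf_sum coef_sum; apply: eq_bigr => m _.
  by rewrite !mxE /= mmapZ coefCM mulrC.
have := mxrank_unit Munit; rewrite ME => rkN.
have := mulmx_max_rank (\matrix_(l < N, m < size e) (jet x y e`_m)`_l)
  (\matrix_(m < size e, n < N) u n m).
by rewrite rkN /N ltnNge leqnSn.
Qed.

(** Newton's iteration, one coefficient at a time. *)
Lemma sqrt_jet (two0 : (2 : k) != 0) (e : k) N :
  exists s : {poly k}, 'X^N %| s ^+ 2 - (1 + e%:P * 'X) /\ s.[0] = 1.
Proof.
case: N => [|N]; first by exists 1; rewrite expr0 dvd1p hornerE.
elim: N => [|N [s [/dvdpP[r sr] s0]]].
  exists 1; rewrite hornerE; split=> //.
  by rewrite (_ : _ - _ = (- e%:P) * 'X^1) ?dvdp_mull //; ring.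
exists (s - (r.[0] / 2)%:P * 'X^(N.+1)); split; last first.
  by rewrite !hornerE s0 expr0n /= mulr0 subr0.
have -> : (s - (r.[0] / 2)%:P * 'X^(N.+1)) ^+ 2 - (1 + e%:P * 'X) =
   (r - (r.[0])%:P * s + (r.[0] / 2)%:P ^+ 2 * 'X^(N.+1)) * 'X^(N.+1).
  have -> : (r.[0])%:P = 2 * (r.[0] / 2)%:P.
    have e2 : r.[0] = r.[0] / 2 * 2 by rewrite divfK.
    by rewrite {1}e2; ring.
  have {}sr : s ^+ 2 = 1 + e%:P * 'X + r * 'X^(N.+1) by rewrite -sr; ring.
  by move: sr; set t := 'X^(N.+1) => sr; ring: sr.
rewrite exprS dvdp_mul // -[X in X %| _]subr0 -polyC0 dvdp_XsubCl.
by apply/rootP; rewrite !hornerE s0 expr0n /=; ring.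
Qed.

Lemma inverse_jet (y : {poly k}) N :
  y.[0] != 0 -> exists z, 'X^N %| z * y - 1.
Proof.
move=> y0; have : coprimep 'X^N y.
  by apply: coprimep_expl; rewrite coprimep_sym coprimepX.
case/Bezout_eq1_coprimepP => -[u z] /= e; exists z.
by rewrite (_ : _ - 1 = - u * 'X^N) ?dvdp_mull // -[X in _ - X]e; ring.
Qed.

Variables al be ga : k.

Lemma jet_Gamma N x y p q :
  'X^N %| x p - 1 -> 'X^N %| y q - 1 ->
  (forall r, r \in rels al%:P be%:P ga%:P x y -> 'X^N %| r) ->
  forall f, Gamma al be ga p q f -> 'X^N %| jet x y f.
Proof.
move=> xp yq xy; have idN := dvd_ideal 'X^N.
apply: ideal_gen_min.
  split=> [|e g h dg dh]; first by rewrite /jet mmap0 dvdp0.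
  by rewrite jetD jetM; apply: idN.2.
move=> _ [[t t_rel ->]|->|->]; last 2 first.
- by rewrite jetB jet_x jet1.
- by rewrite jetB jet_y jet1.
apply: (form11_relations (W := fun g => 'X^N %| jet x y g)) t_rel.
- move=> r /(nthP 0)[l lt_l <-].
  have -> : jet x y (rels al%:MP be%:MP ga%:MP (xvar k) (yvar k))`_l =
      (rels al%:P be%:P ga%:P x y)`_l.
    by case: l lt_l => [|[|[|[|[|[|//]]]]]] _;
      rewrite /= !(jetB, jetD, jetM, jetC, jet_x, jet_y).
  by apply: xy; rewrite mem_nth.
- by move=> e f g df dg; rewrite -mul_mpolyC jetD jetM; apply: idN.2.
- by rewrite /jet mmap0 dvdp0.
Qed.

End Jets.

Section InfiniteCases.

Variable k : fieldType.
Hypothesis two0 : (2 : k) != 0.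

Lemma line_not_finite (al be ga : k) (x : 'I_4 -> {poly k}) p l :
  x p = 1 -> x l = 'X ->
  (forall r, r \in rels al%:P be%:P ga%:P x x -> r = 0) ->
  ~ finite_subscheme (Gamma al be ga).
Proof.
move=> xp xl xx; apply: (@jets_not_finite _ _ p p) => N; exists x, x; split.
  apply: jet_Gamma; rewrite ?xp ?subrr ?dvdp0 // => r /xx ->; exact: dvdp0.
by exists (xvar k l); rewrite jet_x xl !coefX oner_eq0.
Qed.

(** When a parameter vanishes, [Gamma] contains the diagonal of a coordinate
    line. *)
Lemma parameter_neq0 (al be ga : k) :
  finite_subscheme (Gamma al be ga) -> al * be * ga != 0.
Proof.
move=> fin; rewrite -mulrA !mulf_eq0 !negb_or; apply/and3P; split.
- apply/eqP => al0; move: fin; apply: (@line_not_finite _ _ _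
    (fun m => [:: 0; 0; 'X; 1]`_m) 3 2) => // r /(nthP 0)[l lt_l <-].
  by rewrite al0; case: l lt_l => [|[|[|[|[|[|//]]]]]] _ /=; rewrite ?polyC0; ring.
- apply/eqP => be0; move: fin; apply: (@line_not_finite _ _ _
    (fun m => [:: 0; 'X; 0; 1]`_m) 3 1) => // r /(nthP 0)[l lt_l <-].
  by rewrite be0; case: l lt_l => [|[|[|[|[|[|//]]]]]] _ /=; rewrite ?polyC0; ring.
- apply/eqP => ga0; move: fin; apply: (@line_not_finite _ _ _
    (fun m => [:: 0; 'X; 1; 0]`_m) 2 1) => // r /(nthP 0)[l lt_l <-].
  by rewrite ga0; case: l lt_l => [|[|[|[|[|[|//]]]]]] _ /=; rewrite ?polyC0; ring.
Qed.

(** The determinant of the system is [alpha + beta + gamma + alpha beta gamma].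
    The solution read off from the first two equations is zero when
    [be = -1] and [al = 1]; the one read off from the next two is then
    nonzero. *)
Lemma kernel_vector (al be ga : k) : al + be + ga + al * be * ga = 0 ->
  exists c1 c2 c3 : k, [/\ al * c1 + c2 - c3 = 0, be * c2 + c3 - c1 = 0,
    ga * c3 + c1 - c2 = 0 & [|| c1 != 0, c2 != 0 | c3 != 0]].
Proof.
move=> delta0.
case: (boolP ((1 + be == 0) && (1 - al == 0))) => [/andP[/eqP be1 /eqP al1] | nz].
  exists (1 - ga), (1 + ga), 2; rewrite two0 !orbT.
  have -> : be = -1 by rewrite -[be](addKr 1) be1 addr0.
  have -> : al = 1 by rewrite -[al]opprK -[- al](addKr 1) al1 addr0 opprK.
  by split=> //; ring.
exists (1 + be), (1 - al), (1 + al * be); split; try ring.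
  by rewrite -[RHS]delta0; ring.
by rewrite orbA -negb_and nz.
Qed.

(** Take [x = (1, s1 / (b c), s2 / (a c), s3 / (a b))] with
    [s_j ^ 2 = 1 + c_j t], a curve through the point [(a b c, a, b, c)].  The
    forms [L_1], [L_2], [L_3] vanish along it when [(c1, c2, c3)] is a vector
    of [kernel_vector].  The second point [Y] is given by cubic forms in
    [x] that turn three of the relations into identities and the other three
    into multiples of [L_1], [L_2], [L_3]; on the elliptic curve of the
    nondegenerate case they define the translation attached to the algebra. *)
Lemma delta_neq0 (a b c : k) : a != 0 -> b != 0 -> c != 0 ->
  finite_subscheme (Gamma (a ^+ 2) (b ^+ 2) (c ^+ 2)) ->
  a ^+ 2 + b ^+ 2 + c ^+ 2 + a ^+ 2 * b ^+ 2 * c ^+ 2 != 0.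
Proof.
move=> a0 b0 c0 fin; apply/eqP => delta0.
have [c1 [c2 [c3 [k1 k2 k3 nz]]]] := kernel_vector delta0.
move: fin; apply: (@jets_not_finite _ _ 0 0) => N.
have [s1 [d1 s10]] := sqrt_jet two0 c1 N.
have [s2 [d2 s20]] := sqrt_jet two0 c2 N.
have [s3 [d3 s30]] := sqrt_jet two0 c3 N.
set A := (b * c)^-1; set B := (a * c)^-1; set C := (a * b)^-1.
pose x (m : 'I_4) : {poly k} := [:: 1; A%:P * s1; B%:P * s2; C%:P * s3]`_m.
pose al := (a ^+ 2)%:P; pose be := (b ^+ 2)%:P; pose ga := (c ^+ 2)%:P.
pose Y : 'I_4 -> {poly k} := fun m => [::
  1 - be * ga * x 1 ^+ 2 - al * ga * x 2 ^+ 2 - al * be * x 3 ^+ 2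
    - 2 * al * be * ga * x 1 * x 2 * x 3;
  2 * al * x 2 * x 3
    + x 1 * (1 - be * ga * x 1 ^+ 2 + al * ga * x 2 ^+ 2 + al * be * x 3 ^+ 2);
  2 * be * x 1 * x 3
    + x 2 * (1 + be * ga * x 1 ^+ 2 - al * ga * x 2 ^+ 2 + al * be * x 3 ^+ 2);
  2 * ga * x 1 * x 2
    + x 3 * (1 + be * ga * x 1 ^+ 2 + al * ga * x 2 ^+ 2 - al * be * x 3 ^+ 2)]`_m.
have eA : A * (b * c) = 1 by rewrite mulVf ?mulf_neq0.
have eB : B * (a * c) = 1 by rewrite mulVf ?mulf_neq0.
have eC : C * (a * b) = 1 by rewrite mulVf ?mulf_neq0.
have X1 : be * ga * x 1 ^+ 2 = s1 ^+ 2.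
  rewrite (_ : _ * _ = ((A * (b * c)) ^+ 2)%:P * s1 ^+ 2); last by rewrite /x /=; ring.
  by rewrite eA expr1n mul1r.
have X2 : al * ga * x 2 ^+ 2 = s2 ^+ 2.
  rewrite (_ : _ * _ = ((B * (a * c)) ^+ 2)%:P * s2 ^+ 2); last by rewrite /x /=; ring.
  by rewrite eB expr1n mul1r.
have X3 : al * be * x 3 ^+ 2 = s3 ^+ 2.
  rewrite (_ : _ * _ = ((C * (a * b)) ^+ 2)%:P * s3 ^+ 2); last by rewrite /x /=; ring.
  by rewrite eC expr1n mul1r.
have X123 : al * be * ga * x 1 * x 2 * x 3 = s1 * s2 * s3.
  rewrite (_ : al * _ * _ * _ * _ * _ =
    ((A * (b * c)) * (B * (a * c)) * (C * (a * b)))%:P * (s1 * s2 * s3)).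
    by rewrite eA eB eC !mul1r.
  by rewrite /x /=; ring.
(* At the parameter 0 all [s_j] are 1, and [Y 0] is -4. *)
have Y0 : (Y 0).[0] != 0.
  have -> : Y 0 = 1 - s1 ^+ 2 - s2 ^+ 2 - s3 ^+ 2 - 2 * (s1 * s2 * s3).
    by rewrite -X123 -X1 -X2 -X3 /Y /=; ring.
  rewrite !hornerE s10 s20 s30 /= (_ : _ - _ = - (2 * 2)); last by ring.
  by rewrite oppr_eq0 mulf_neq0.
have [z dz] := inverse_jet N Y0.
have idN := dvd_ideal ('X^N : {poly k}).
have L1 : 'X^N %| 1 - be * ga * x 1 ^+ 2 - ga * x 2 ^+ 2 + be * x 3 ^+ 2.
  apply: (@ideal_scalar _ _ (@polyC k) _ idN (a ^+ 2)); first exact: expf_neq0.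
  rewrite [X in _ %| X](_ : _ = al - al * s1 ^+ 2 - s2 ^+ 2 + s3 ^+ 2); last first.
    by rewrite -X1 -X2 -X3 /al /be /ga /=; ring.
  apply: (ideal_sub idN (c := - al) d1); apply: (ideal_sub idN (c := - 1) d2).
  apply: (ideal_sub idN (c := 1) d3); apply: (ideal_eq0 idN).
  transitivity (- (a ^+ 2 * c1 + c2 - c3)%:P * 'X); first by rewrite /al; ring.
  by rewrite k1 oppr0 mul0r.
have L2 : 'X^N %| 1 + ga * x 1 ^+ 2 - ga * al * x 2 ^+ 2 - al * x 3 ^+ 2.
  apply: (@ideal_scalar _ _ (@polyC k) _ idN (b ^+ 2)); first exact: expf_neq0.
  rewrite [X in _ %| X](_ : _ = be + s1 ^+ 2 - be * s2 ^+ 2 - s3 ^+ 2); last first.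
    by rewrite -X1 -X2 -X3 /al /be /ga /=; ring.
  apply: (ideal_sub idN (c := 1) d1); apply: (ideal_sub idN (c := - be) d2).
  apply: (ideal_sub idN (c := - 1) d3); apply: (ideal_eq0 idN).
  transitivity (- (b ^+ 2 * c2 + c3 - c1)%:P * 'X); first by rewrite /be; ring.
  by rewrite k2 oppr0 mul0r.
have L3 : 'X^N %| 1 - be * x 1 ^+ 2 + al * x 2 ^+ 2 - al * be * x 3 ^+ 2.
  apply: (@ideal_scalar _ _ (@polyC k) _ idN (c ^+ 2)); first exact: expf_neq0.
  rewrite [X in _ %| X](_ : _ = ga - s1 ^+ 2 + s2 ^+ 2 - ga * s3 ^+ 2); last first.
    by rewrite -X1 -X2 -X3 /al /be /ga /=; ring.
  apply: (ideal_sub idN (c := - 1) d1); apply: (ideal_sub idN (c := 1) d2).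
  apply: (ideal_sub idN (c := - ga) d3); apply: (ideal_eq0 idN).
  transitivity (- (c ^+ 2 * c3 + c1 - c2)%:P * 'X); first by rewrite /ga; ring.
  by rewrite k3 oppr0 mul0r.
exists x, (fun m => z * Y m); split.
  apply: jet_Gamma => //; first by rewrite subrr dvdp0.
  rewrite -/al -/be -/ga => r; rewrite !inE /Y /=.
  have x0 : x 0 = 1 by [].
  move: (x 1) (x 2) (x 3) x0 L1 L2 L3 => t1 t2 t3 -> L1 L2 L3.
  case/orP => [/eqP -> |]; first by apply: (ideal_eq0 idN); ring.
  case/orP => [/eqP -> |].
    apply: (ideal_sub idN (c := 2 * z * (t1 + al * t2 * t3)) L1).
    by apply: (ideal_eq0 idN); ring.
  case/orP => [/eqP -> |]; first by apply: (ideal_eq0 idN); ring.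
  case/orP => [/eqP -> |].
    apply: (ideal_sub idN (c := 2 * z * (t2 + be * t3 * t1)) L2).
    by apply: (ideal_eq0 idN); ring.
  case/orP => /eqP ->; first by apply: (ideal_eq0 idN); ring.
  apply: (ideal_sub idN (c := 2 * z * (t3 + ga * t1 * t2)) L3).
  by apply: (ideal_eq0 idN); ring.
have simple_zero (e : k) (s : {poly k}) : e != 0 -> s.[0] = 1 ->
    'X^N %| s ^+ 2 - (1 + e%:P * 'X) ->
    (s ^+ 2 - 1)`_0 = 0 /\ ((1 < N)%N -> (s ^+ 2 - 1)`_1 != 0).
  move=> e0 s0 /dvdpP[r sr]; split=> [|lt1N].
    by rewrite -horner_coef0 !hornerE s0; ring.
  rewrite (_ : _ - 1 = e%:P * 'X + r * 'X^N); last by rewrite -sr; ring.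
  by rewrite coefD coefMX coefC coefMXn lt1N addr0.
case/or3P: nz => nz.
- exists ((b ^+ 2 * c ^+ 2)%:MP * xvar k 1 ^+ 2 - 1).
  rewrite jetB jetM jetXn jetC jet1 jet_x polyCM X1.
  exact: (simple_zero c1).
- exists ((a ^+ 2 * c ^+ 2)%:MP * xvar k 2 ^+ 2 - 1).
  rewrite jetB jetM jetXn jetC jet1 jet_x polyCM X2.
  exact: (simple_zero c2).
- exists ((a ^+ 2 * b ^+ 2)%:MP * xvar k 3 ^+ 2 - 1).
  rewrite jetB jetM jetXn jetC jet1 jet_x polyCM X3.
  exact: (simple_zero c3).
Qed.

End InfiniteCases.

(** * Conclusion *)

Lemma two_neq0 (k : fieldType) : 2%N \notin [pchar k] -> (2 : k) != 0.
Proof. by apply: contraNneq => two0; rewrite !inE /= two0. Qed.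

Section Conclusion.

Variables (k : fieldType) (i a b c : k).
Hypotheses (two0 : (2 : k) != 0) (hi : i ^+ 2 = -1).
Hypotheses (a0 : a != 0) (b0 : b != 0) (c0 : c != 0).

Let idzero : is_ideal (fun e : k => e = 0).
Proof. by split=> [//|e h f -> ->]; rewrite mulr0 addr0. Qed.

Lemma graph_pairs_rels v w : (v, w) \in graph_pairs i a b c ->
  forall r, r \in rels (a ^+ 2) (b ^+ 2) (c ^+ 2) (fun m => v 0 m)
                       (fun m => w 0 m) -> r = 0.
Proof.
pose sol (v w : 'rV[k]_4) := solves (fun e : k => e = 0) (a ^+ 2) (b ^+ 2)
  (c ^+ 2) 1 (fun m => v 0 m) (fun m => w 0 m).
suff sol_pairs v' w' : (v', w') \in graph_pairs i a b c -> sol v' w'.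
  by move=> /sol_pairs H r /H; rewrite mul1r.
have twist_sol s u t : s \in signs k -> sol u t ->
    sol (twist_row s u) (twist_row s t).
  move=> s_in H; have := solves_twist idzero s_in H.
  move=> /solvesP K; apply/solvesP => l; rewrite -[RHS](K l) /twist.
  by case: l {K} => [[|[|[|[|[|[|//]]]]]] lt_l] /=; rewrite !mxE.
have base x0 x1 x2 x3 y0 y1 y2 y3 :
    (forall r, r \in rels (a ^+ 2) (b ^+ 2) (c ^+ 2)
       (fun m : 'I_4 => [:: x0; x1; x2; x3]`_m)
       (fun m : 'I_4 => [:: y0; y1; y2; y3]`_m) -> r = 0) ->
    sol (vec4 x0 x1 x2 x3) (vec4 y0 y1 y2 y3).
  move=> H r r_in; rewrite mul1r; apply: H; move: r_in.
  by rewrite /rels !mxE.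
rewrite /graph_pairs !mem_cat => /or4P[|||/orP[]] /mapP[s s_in [-> ->]].
- apply/solvesP => l; elim/forall_ord4: s {s_in};
  by case: l => [[|[|[|[|[|[|//]]]]]] lt_l] /=; rewrite !mxE /=; ring.
- apply: twist_sol => //; apply: base => r /(nthP 0)[l lt_l <-].
  by case: l lt_l => [|[|[|[|[|[|//]]]]]] _ /=; ring: hi.
- apply: twist_sol => //; apply: base => r /(nthP 0)[l lt_l <-].
  by case: l lt_l => [|[|[|[|[|[|//]]]]]] _ /=; ring: hi.
- apply: twist_sol => //; apply: base => r /(nthP 0)[l lt_l <-].
  by case: l lt_l => [|[|[|[|[|[|//]]]]]] _ /=; ring: hi.
- apply: twist_sol => //; apply: base => r /(nthP 0)[l lt_l <-].
  by case: l lt_l => [|[|[|[|[|[|//]]]]]] _ /=; ring: hi.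
Qed.

Lemma graph_pairs_neq0 v w :
  (v, w) \in graph_pairs i a b c -> (v != 0) && (w != 0).
Proof.
have [t0 t1 t2 t3] := torus_u hi a0 b0 c0.
have [r0 r1 r2 r3] := torus_w hi a0 b0 c0.
have nz s u : s \in signs k -> torus u -> twist_row s u != 0.
  move=> s_in tu; apply: contraNneq (tu 0) => /rowP/(_ 0); rewrite !mxE => /eqP.
  by rewrite mulf_eq0; move: s_in; rewrite !inE; case/or4P => /eqP -> /=;
    rewrite oner_eq0.
rewrite /graph_pairs !mem_cat => /or4P[|||/orP[]] /mapP[s s_in [-> ->]].
- have -> : coord_row k s != 0; last by [].
  apply: contraNneq (oner_neq0 k) => /rowP/(_ s); rewrite !mxE eqxx => /eqP.
  by [].
- by rewrite !nz.
- by rewrite !nz.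
- by rewrite !nz.
- by rewrite !nz.
Qed.

Lemma vanishes_at_points p q f :
  vanishes_at p q (graph_pairs i a b c) f <->
  points_subscheme (theta_graph i a b c) p q f.
Proof.
have mem_graph := mem_theta_graph two0 hi a0 b0 c0; split=> f0.
  move=> P Q v w /mem_graph[v' [w' [vw -> ->]]].
  move=> /vlineP[e ->] /vlineP[d ->]; rewrite !mxE => ev dw.
  have vp : v' 0 p != 0.
    by apply: contra_eq_neq ev => ->; rewrite mulr0 eq_sym oner_neq0.
  have wq : w' 0 q != 0.
    by apply: contra_eq_neq dw => ->; rewrite mulr0 eq_sym oner_neq0.
  have -> : e = (v' 0 p)^-1 by rewrite -[e](mulfK vp) ev mul1r.
  have -> : d = (w' 0 q)^-1 by rewrite -[d](mulfK wq) dw mul1r.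
  exact: f0.
move=> v w vw vp wq; apply: (f0 <[v]>%VS <[w]>%VS).
- by apply/mem_graph; exists v, w.
- by rewrite memvZ ?memv_line.
- by rewrite memvZ ?memv_line.
- by rewrite mxE mulVf.
- by rewrite mxE mulVf.
Qed.

End Conclusion.

Theorem proposition3p4 (k : fieldType) (hchar : 2%N \notin [pchar k])
    (i : k) (hi : i ^+ 2 = - 1)
    (alpha beta gamma a b c : k)
    (ha : a ^+ 2 = alpha) (hb : b ^+ 2 = beta) (hc : c ^+ 2 = gamma) :
  finite_subscheme (Gamma alpha beta gamma) ->
  [/\ alpha * beta * gamma != 0,
      {in PP i a b c &, injective (theta i a b c)},
      [fset theta i a b c p | p in PP i a b c] = ominusPP i a b c,
      eq_subscheme (Gamma alpha beta gamma)
        (points_subscheme (theta_graph i a b c))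
    & #|` theta_graph i a b c| = 20%N].
Proof.
move: ha hb hc => <- <- <- fin; have two0 := two_neq0 hchar.
have abc0 := parameter_neq0 fin.
have /and3P[a0 b0 c0] : [&& a != 0, b != 0 & c != 0].
  by move: abc0; rewrite -mulrA !mulf_eq0 !negb_or !andbb.
have delta0 := delta_neq0 two0 a0 b0 c0 fin.
split=> //; [exact: theta_inj | exact: theta_image | | exact: card_theta_graph].
move=> p q f; split=> [Gf | /(vanishes_at_points two0 hi a0 b0 c0) f0].
  apply/(vanishes_at_points two0 hi a0 b0 c0).
  by apply: Gamma_vanishes Gf => v w; apply: graph_pairs_rels.
apply: (Gamma_reduced two0 hi a0 b0 c0 delta0) f0 => v w.
exact: graph_pairs_neq0.
Qed.
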